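(* Let $n\ge 1$ be an integer and $c>0$. Let $B_1,\ldots,B_n$ be independent Bernoulli random variables with $\mathbb{E}B_k=1/k$, and let $P_1,\ldots,P_n$ be independent Poisson random variables, independent of the $B_k$, with $P_k\sim\mathrm{Pois}(ck/n)$. Let $$W=\sum_{k=1}^nB_kP_k,$$ and let $Z\sim\mathrm{MP}(cD)$, where $D$ has the standard Dickman distribution. Then $$d_{\mathrm{TV}}(W,Z)\leq\frac{5c^2}{2n}\min\left\{1,\frac{1}{\beta}\left(\frac{1}{4\beta}+\log^+2\beta\right)\right\},\qquad\text{where }\beta=ce^{-c}.$$
   Context: The standard Dickman distribution $\mathrm{Dickman}(1)$ is the distribution on $(0,\infty)$ with density $e^{-\gamma}\rho(x)$, $x>0$, where $\gamma=0.5772\ldots$ is Euler's constant and $\rho$ is Dickman's function (the continuous function with $\rho(x)=1$ for $0\le x\le 1$ and $x\rho'(x)=-\rho(x-1)$ for $x>1$). It has mean $1$. Mixed Poisson: $Z\sim\mathrm{MP}(\xi)$ for a non-negative random variable $\xi$ means that, conditionally on $\xi$, $Z$ is Poisson with mean $\xi$, i.e. $\mathbb{P}(Z=j)=\mathbb{E}[e^{-\xi}\xi^j]/j!$ for $j=0,1,2,\ldots$. Total variation distance: $d_{\mathrm{TV}}(W,Z)=\sup_{A\subseteq\mathbb{Z}^+}|\mathbb{P}(W\in A)-\mathbb{P}(Z\in A)|$, with $\mathbb{Z}^+=\{0,1,2,\ldots\}$. $\log^+$ denotes the positive part of the natural logarithm, and $\log^+2\beta=\log^+(2\beta)$. *)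

(* Defs.v *)
From HB Require Import structures.
From mathcomp Require Export all_boot all_order all_algebra.
From mathcomp Require Export all_classical all_reals all_analysis.

Set Implicit Arguments.
Unset Strict Implicit.
Unset Printing Implicit Defensive.

Export Order.TTheory GRing.Theory Num.Theory.
Export numFieldNormedType.Exports.

Local Open Scope classical_set_scope.
Local Open Scope ring_scope.

(* [series harmonic n] is the n-th harmonic number 1 + 1/2 + ... + 1/n. *)
Definition euler_gamma {R : realType} : R :=
  limn (fun n : nat => series harmonic n - ln n%:R).

(* The conditions determine [rho] on [0, +oo[ and leave it arbitrary on the
   negative half-line, which plays no role below. *)
Definition dickman_function {R : realType} (rho : R -> R) : Prop :=
  [/\ {within `[0, +oo[, continuous rho},
      forall x : R, 0 <= x <= 1 -> rho x = 1 &
      forall x : R, 1 < x ->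
        derivable rho x 1 /\ x * (rho^`()%classic) x = - rho (x - 1)].

Definition standard_dickman d (T : measurableType d) (R : realType)
    (P : probability T R) (D : {RV P >-> R}) : Prop :=
  exists2 rho : R -> R, dickman_function rho &
    forall A : set R, measurable A ->
      distribution P D A =
      (\int[lebesgue_measure]_(x in A `&` `]0%R, +oo[)
         (expR (- euler_gamma) * rho x)%:E)%E.

(* [poisson_pmf r] is the Poisson mass function only for r > 0. *)
Definition poisson_distributed d (T : measurableType d) (R : realType)
    (P : probability T R) (r : R) (X : {RV P >-> nat}) : Prop :=
  forall j : nat, P [set w | X w = j] = (poisson_pmf r j)%:E.

(* Meant for xi >= 0 almost surely.  Only the laws matter, so Z and xi may live
   on different probability spaces. *)
Definition mixed_poisson d (T : measurableType d) d' (T' : measurableType d')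
    (R : realType) (P : probability T R) (P' : probability T' R)
    (xi : T' -> R) (Z : {RV P >-> nat}) : Prop :=
  forall j : nat,
    P [set w | Z w = j] =
    ('E_P'[(fun w => expR (- xi w) * xi w ^+ j)%R] * (j`!%:R^-1)%:E)%E.

Definition sigma_of {d} {T : Type} {T' : measurableType d} (X : T -> T') :
    set (set T) :=
  preimage_set_system setT X measurable.

Definition independent_systems d (T : measurableType d) (R : realType)
    (P : probability T R) (I : finType) (F : I -> set (set T)) : Prop :=
  forall (J : {set I}) (A : I -> set T),
    (forall i, i \in J -> F i (A i)) ->
    P (\bigcap_(i in [set` J]) A i) = (\prod_(i in J) P (A i))%E.

Definition dTV d (T : measurableType d) d' (T' : measurableType d')
    (R : realType) (P : probability T R) (P' : probability T' R)
    (W : T -> nat) (Z : T' -> nat) : \bar R :=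
  ereal_sup [set `|P (W @^-1` A) - P' (Z @^-1` A)|%E | A in [set: set nat]].

Definition log_plus {R : realType} (x : R) : R := Num.max 0 (ln x).

Arguments standard_dickman {d T R} P D.
Arguments poisson_distributed {d T R} P r X.
Arguments mixed_poisson {d T d' T' R} P P' xi Z.

(* Main.v *)
Require Import Defs.
From mathcomp Require Import measurable_realfun.
From mathcomp Require Import ring lra zify.

Set Implicit Arguments.
Unset Strict Implicit.
Unset Printing Implicit Defensive.

Local Open Scope classical_set_scope.
Local Open Scope ring_scope.

(** Since [c * expR (- c) <= 1 / 2], the minimum in the bound is always [1]
    ([min_factor_eq1]); what has to be shown is that the two laws are within
    [5 c^2 / (2 n)] of each other.

    Write [N_y] for a Poisson variable of mean [y] independent of everything
    else and put [d = c / n].  For a bounded [h] let [H m] be the average of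
    [h 0, ..., h m] and let [K h m = E H (m + N_c)] ([avg], [kstep]).

    The law of [Z] is invariant under [K], that is [E h(Z) = E (K h)(Z)].  This
    is the self-similarity of the Dickman law: [D] has the law of [U (1 + D)]
    with [U] uniform on [[0, 1]], and multiplying a mixed Poisson parameter by
    [U] thins an integer [m] to a uniform element of [{0, ..., m}].  On
    probabilities it reads [(j + 1) (z_j - z_(j+1)) = P(Z + N_c = j)], obtained
    from [x rho'(x) = - rho(x - 1)] by integrating the derivative of
    [x rho(x) P(N_(c x) = j)] ([dickman_int_parts], [dickman_recursion],
    [mean_fixed_point]).

    The law of [W] is nearly invariant.  With [f m = H m - H (m - 1)] one has
    [h m = H m + m f m], so [h - K h] splits into a size-bias term and a
    Poisson translation.  For the first, [E (m f m)] at [W] is the sum over [k]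
    of [d E f (W + N_(d k) + 1)], up to an error of [n d^2] times the largest
    increment of [f] ([sumshift_size_bias]); for the second,
    [E H (W + N_c) - E H(W)] telescopes along [N_(d k)], each step being
    [d E f (W + N_(d k) + 1)] to second order ([sumshift_pshift]).  The common
    main terms cancel and the remainder is at most [(5/2) n d^2] times the
    largest second difference of [H] ([sumshift_kstep]).

    Averaging divides second differences by three and first differences by
    two ([davg_lip], [avg_lip]).  Comparing [h, K h, K (K h), ...] at [W], the
    errors form a geometric series, whose sum is [5 c^2 / (2 n)] for an
    indicator [h]; along the iteration [K^N h] flattens to a constant, which
    gives the same value at [W] and at [Z] ([sumshift_fixed_point_dist]). *)

(** * Means of bounded sequences under laws on the naturals *)

Section Laws.
Context {R : realType}.
Implicit Types (p q g h : nat -> R).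

Definition is_bounded g : Prop := exists C, forall m, `|g m| <= C.

Definition is_law p : Prop := (forall i, 0 <= p i) /\ series p @ \oo --> (1 : R).

Definition mean p g : R := limn (series (fun i => p i * g i)).

Lemma mean_eq p g l : series (fun i => p i * g i) @ \oo --> l -> mean p g = l.
Proof. by move=> /cvg_lim; apply. Qed.

Lemma is_bounded_cst (a : R) : is_bounded (fun=> a).
Proof. by exists `|a|. Qed.

Lemma is_boundedD g h : is_bounded g -> is_bounded h ->
  is_bounded (fun m => g m + h m).
Proof.
move=> [C gC] [C' hC]; exists (C + C') => m.
by apply: (le_trans (ler_normD _ _)); apply: lerD.
Qed.

Lemma is_boundedZ a g : is_bounded g -> is_bounded (fun m => a * g m).
Proof.
by move=> [C gC]; exists (`|a| * C) => m; rewrite normrM ler_wpM2l.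
Qed.

Lemma is_boundedB g h : is_bounded g -> is_bounded h ->
  is_bounded (fun m => g m - h m).
Proof.
move=> [C gC] [C' hC]; exists (C + C') => m.
by apply: (le_trans (ler_normB _ _)); apply: lerD.
Qed.

Lemma is_bounded_comp g (f : nat -> nat) : is_bounded g ->
  is_bounded (fun m => g (f m)).
Proof. by move=> [C gC]; exists C. Qed.

Lemma mean_cvg p g : is_law p -> is_bounded g ->
  series (fun i => p i * g i) @ \oo --> mean p g.
Proof.
move=> [p0 p1] [C gC]; apply: normed_cvg.
apply: (@series_le_cvg _ _ (fun i => p i * C)) => [i|i|i|].
- exact: normr_ge0.
- by rewrite mulr_ge0// (le_trans _ (gC 0%N)).
- by rewrite /= normrM (ger0_norm (p0 i)) ler_wpM2l.
apply/cvg_ex; exists (1 * C).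
rewrite (_ : series _ = fun n => series p n * C); first exact: cvgMr_tmp.
by apply/funext => n; rewrite /series/= mulr_suml.
Qed.

Lemma meanD p g h : is_law p -> is_bounded g -> is_bounded h ->
  mean p (fun i => g i + h i) = mean p g + mean p h.
Proof.
move=> lp bg bh; apply: mean_eq.
rewrite (_ : series _ = series (fun i => p i * g i) + series (fun i => p i * h i)).
  by apply: cvgD; exact: mean_cvg.
by rewrite -seriesD; congr series; apply/funext => i /=; rewrite mulrDr.
Qed.

Lemma meanZ p a g : is_law p -> is_bounded g -> mean p (fun i => a * g i) =
  a * mean p g.
Proof.
move=> lp bg; apply: mean_eq.
rewrite (_ : series _ = fun n => a * series (fun i => p i * g i) n).
  by apply: cvgMl_tmp; exact: mean_cvg.
apply/funext => n; rewrite /series/= mulr_sumr; apply: eq_bigr => i _; ring.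
Qed.

Lemma meanB p g h : is_law p -> is_bounded g -> is_bounded h ->
  mean p (fun i => g i - h i) = mean p g - mean p h.
Proof.
move=> lp bg bh.
rewrite (_ : (fun i => g i - h i) = (fun i => g i + (-1) * h i)).
  by rewrite meanD// ?meanZ ?mulN1r//; exact: is_boundedZ.
by apply/funext => i; rewrite mulN1r.
Qed.

Lemma mean_cst p a : is_law p -> mean p (fun=> a) = a.
Proof.
move=> [p0 p1]; apply: mean_eq; rewrite -[X in _ --> X](mul1r a).
rewrite (_ : series _ = fun n => series p n * a); first exact: cvgMr_tmp.
by apply/funext => n; rewrite /series/= mulr_suml.
Qed.

Lemma mean_le p g h : is_law p -> is_bounded g -> is_bounded h ->
  (forall i, g i <= h i) ->
  mean p g <= mean p h.
Proof.
move=> lp bg bh gh; apply: (ler_cvg_to (mean_cvg lp bg) (mean_cvg lp bh)).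
apply: nearW => n; apply: ler_sum => i _; rewrite ler_wpM2l//; exact: lp.1.
Qed.

Lemma mean_norm p g C : is_law p -> (forall i, `|g i| <= C) -> `|mean p g| <= C.
Proof.
move=> lp gC; have bg : is_bounded g by exists C.
rewrite ler_norml; apply/andP; split.
  rewrite -(mean_cst (- C) lp); apply: mean_le => //; first exact: is_bounded_cst.
  by move=> i; have := gC i; rewrite ler_norml => /andP[].
rewrite -(mean_cst C lp); apply: mean_le => //; first exact: is_bounded_cst.
by move=> i; have := gC i; rewrite ler_norml => /andP[].
Qed.

Lemma eq_mean p g h : g =1 h -> mean p g = mean p h.
Proof. by move=> /funext ->. Qed.

Definition conv p q : nat -> R := fun m => \sum_(i < m.+1) p i * q (m - i)%N.

Lemma nneseriesE (u : nat -> R) (l : R) :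
  series u @ \oo --> l -> (\sum_(i <oo) (u i)%:E = l%:E)%E.
Proof.
have E : eseries (fun i => (u i)%:E) = EFin \o series u.
  by apply/funext => n /=; rewrite /eseries/series/= sumEFin.
move=> cu; change (limn (eseries (fun i => (u i)%:E)) = l%:E); rewrite E.
by apply: cvg_lim => //; apply: cvg_EFin => //; exact: nearW.
Qed.

Lemma cvg_series_nneseries (u : nat -> R) (l : R) : (forall i, 0 <= u i) ->
  (\sum_(i <oo) (u i)%:E = l%:E)%E -> series u @ \oo --> l.
Proof.
move=> u0 lu.
have cu : cvgn (series u) by apply: nnseries_is_cvg => //; rewrite lu ltry.
have : limn (series u) = l by have := nneseriesE cu; rewrite lu => -[].
by move=> <-.
Qed.

Lemma is_bounded_mean q g : is_law q -> is_bounded g ->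
  is_bounded (fun i => mean q (fun j => g (i + j)%N)).
Proof. by move=> lq [C gC]; exists C => m; apply: mean_norm. Qed.

(** Both sides are the double series of [p i * q j * g (i + j)], summed along
    diagonals or by rows; nonnegativity allows the exchange. *)
Lemma mean_conv_ge0 p q g : is_law p -> is_law q -> is_bounded g ->
  (forall m, 0 <= g m) ->
  series (fun m => conv p q m * g m) @ \oo --> mean p (fun i => mean q (fun j => g (i + j)%N)).
Proof.
move=> lp lq bg g0; have [p0 _] := lp; have [q0 _] := lq.
pose F i m := if (i <= m)%N then p i * q (m - i)%N * g m else 0.
have F0 i m : 0 <= F i m by rewrite /F; case: ifP => // _; rewrite !mulr_ge0.
have c0 m : 0 <= conv p q m * g m.
  by rewrite mulr_ge0// sumr_ge0// => i _; rewrite mulr_ge0.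
apply: cvg_series_nneseries => //.
transitivity (\sum_(m <oo) \sum_(i <oo) (F i m)%:E)%E.
  apply: eq_eseriesr => m _.
  rewrite (@nneseries_split _ _ 0%N m.+1); last by move=> k _; rewrite lee_fin.
  rewrite add0n [X in (_ = _ + X)%E]eseries0 ?adde0; last first.
    by move=> i mi _; rewrite /F leqNgt mi.
  rewrite big_mkord sumEFin; congr EFin; rewrite mulr_suml; apply: eq_bigr => i _.
  by rewrite /F -ltnS ltn_ord.
rewrite nneseries_interchange; last by move=> *; rewrite lee_fin.
transitivity (\sum_(i <oo) (p i * mean q (fun j => g (i + j)%N))%:E)%E; last first.
  by apply: nneseriesE; apply: mean_cvg => //; exact: is_bounded_mean.
apply: eq_eseriesr => i _.
rewrite (@nneseries_split _ _ 0%N i); last by move=> k _; rewrite lee_fin.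
rewrite big1_seq ?add0e ?add0n; last first.
  move=> m /=; rewrite mem_index_iota => /andP[_ mi].
  by rewrite /F leqNgt mi.
rewrite -nneseries_addn; last by move=> m; rewrite lee_fin.
transitivity (\sum_(m <oo) (p i * (q m * g (i + m)%N))%:E)%E.
  by apply: eq_eseriesr => m _; rewrite /F leq_addl addnK mulrA (addnC m).
apply: nneseriesE.
rewrite (_ : series _ = fun n => p i * series (fun m => q m * g (i + m)%N) n).
  by apply: cvgMl_tmp; apply: mean_cvg => //; exact: (is_bounded_comp (addn i)).
by apply/funext => n; rewrite /series/= mulr_sumr.
Qed.

Lemma conv_law p q : is_law p -> is_law q -> is_law (conv p q).
Proof.
move=> lp lq; split=> [m|].
  by rewrite sumr_ge0// => i _; rewrite mulr_ge0//; [exact: lp.1|exact: lq.1].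
have := mean_conv_ge0 lp lq (is_bounded_cst 1) (fun=> ler01).
rewrite (mean_cst _ lq) (mean_cst _ lp).
by rewrite (_ : (fun m => _) = conv p q)//; apply/funext => m; rewrite mulr1.
Qed.

(** Adding a constant makes [g] nonnegative and changes both sides by the
    same amount. *)
Lemma mean_conv p q g : is_law p -> is_law q -> is_bounded g ->
  mean (conv p q) g = mean p (fun i => mean q (fun j => g (i + j)%N)).
Proof.
move=> lp lq bg; have [C gC] := bg.
have bgC : is_bounded (fun m => g m + C) by apply: is_boundedD => //;
  exact: is_bounded_cst.
have gC0 m : 0 <= g m + C by have := gC m; rewrite ler_norml; lra.
have := mean_eq (mean_conv_ge0 lp lq bgC gC0).
rewrite meanD//; [|exact: conv_law|exact: is_bounded_cst].
rewrite (mean_cst C (conv_law lp lq)).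
rewrite (_ : (fun i => _) = (fun i => mean q (fun j => g (i + j)%N) + C)); last first.
  apply/funext => i; rewrite meanD ?mean_cst//; last exact: is_bounded_cst.
  exact: (is_bounded_comp (addn i)).
rewrite meanD ?mean_cst//; [by move/addIr|exact: is_bounded_mean|exact:
  is_bounded_cst].
Qed.

End Laws.

(** * Poisson weights and Poisson translations *)

Section Poisson.
Context {R : realType}.
Implicit Types (g h f : nat -> R) (y a b : R).

(** At [y = 0] this is the point mass at [0], which starts the recursion for
    the law of the sum and the telescoping of translations. *)
Definition pois y (i : nat) : R := expR (- y) * (y ^+ i / i`!%:R).

Lemma pois_ge0 y i : 0 <= y -> 0 <= pois y i.
Proof.
by move=> y0; rewrite mulr_ge0 ?expR_ge0// divr_ge0 ?exprn_ge0.
Qed.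

Lemma pois_law y : 0 <= y -> is_law (pois y).
Proof.
move=> y0; split=> [i|]; first exact: pois_ge0.
rewrite (_ : 1 = expR (- y) * expR y :> R); last by rewrite expRN mulVf ?expR_eq0.
rewrite (_ : series _ = fun n => expR (- y) * series (exp_coeff y) n).
  by apply: cvgMl_tmp; exact: is_cvg_series_exp_coeff.
by apply/funext => n; rewrite /series/= mulr_sumr.
Qed.

(** The binomial theorem, in the form that Poisson parameters add. *)
Lemma pois_conv a b : conv (pois a) (pois b) = pois (a + b).
Proof.
apply/funext => m; rewrite /conv /pois opprD expRD (addrC a) exprDn.
rewrite mulr_suml mulr_sumr; apply: eq_bigr => i _.
have im : (i <= m)%N by rewrite -ltnS.
have F : m`!%:R != 0 :> R by rewrite pnatr_eq0 -lt0n fact_gt0.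
have Fi : i`!%:R != 0 :> R by rewrite pnatr_eq0 -lt0n fact_gt0.
have Fmi : (m - i)`!%:R != 0 :> R by rewrite pnatr_eq0 -lt0n fact_gt0.
have E : m`!%:R = 'C(m, i)%:R * (i`!%:R * (m - i)`!%:R) :> R.
  by rewrite -!natrM bin_fact.
have -> : b ^+ (m - i) * a ^+ i *+ 'C(m, i) =
    m`!%:R / (i`!%:R * (m - i)`!%:R) * (b ^+ (m - i) * a ^+ i).
  by rewrite E mulfK ?mulf_neq0// mulr_natl.
by field; rewrite F Fi Fmi.
Qed.

Lemma pois0 i : pois 0 i = (i == 0%N)%:R.
Proof.
rewrite /pois oppr0 expR0 mul1r expr0n; case: i => [|i] /=.
  by rewrite fact0 divr1.
by rewrite mul0r.
Qed.

Lemma poisS y i : i.+1%:R * pois y i.+1 = y * pois y i.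
Proof.
rewrite /pois factS natrM exprS.
have F : i`!%:R != 0 :> R by rewrite pnatr_eq0 -lt0n fact_gt0.
have G : i.+1%:R != 0 :> R by rewrite pnatr_eq0.
by field; rewrite F nat1r G.
Qed.

(** The Poisson size-bias identity [E (N g(N)) = y E g(N + 1)], term by term
    from [poisS].  It is stated with convergence as a conclusion because it is
    applied to the unbounded [g] of the first two moments. *)
Lemma pois_stein y g (l : R) :
  series (fun i => pois y i * g i.+1) @ \oo --> l ->
  series (fun i => pois y i * (i%:R * g i)) @ \oo --> y * l.
Proof.
move=> gl; rewrite -(cvg_shiftS (series _)) /=.
rewrite (_ : (fun n => _) = fun n => y * series (fun i => pois y i * g i.+1) n).
  exact: cvgMl_tmp.
apply/funext => n; rewrite /series/= big_nat_recl// mul0r mulr0 add0r mulr_sumr.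
by apply: eq_bigr => i _; rewrite mulrCA mulrA poisS mulrA.
Qed.

Lemma pois_mean y : 0 <= y -> series (fun i => pois y i * i%:R) @ \oo --> y.
Proof.
move=> /pois_law[_ p1]; rewrite -[X in _ --> X]mulr1.
rewrite (_ : (fun i => _) = (fun i => pois y i * (i%:R * 1))); last first.
  by apply/funext => i; rewrite mulr1.
apply: (@pois_stein y (fun=> 1)).
by under eq_fun do rewrite mulr1.
Qed.

Lemma pois_mean2 y : 0 <= y ->
  series (fun i => pois y i * (i%:R * (i%:R - 1))) @ \oo --> y ^+ 2.
Proof.
move=> y0; rewrite expr2; apply: (@pois_stein y (fun i => i%:R - 1)).
under eq_fun do rewrite -natr1 addrK; exact: pois_mean.
Qed.

(** The mean of [g (m + N)] for [N] Poisson of mean [y]. *)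
Definition pshift y g (m : nat) : R := mean (pois y) (fun i => g (m + i)%N).

Lemma is_bounded_shift g m : is_bounded g -> is_bounded (fun i => g (m + i)%N).
Proof. exact: (is_bounded_comp (addn m)). Qed.

Lemma pshift_norm y g C : 0 <= y -> (forall m, `|g m| <= C) ->
  forall m, `|pshift y g m| <= C.
Proof. by move=> y0 gC m; apply: mean_norm => //; exact: pois_law. Qed.

Lemma pshift_bounded y g : 0 <= y -> is_bounded g -> is_bounded (pshift y g).
Proof. by move=> y0 [C gC]; exists C; apply: pshift_norm. Qed.

Lemma pshiftD y g h : 0 <= y -> is_bounded g -> is_bounded h ->
  pshift y (fun m => g m + h m) = (fun m => pshift y g m + pshift y h m).
Proof.
by move=> y0 bg bh; apply/funext => m; rewrite /pshift meanD//;
  [exact: pois_law|exact: is_bounded_shift..].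
Qed.

Lemma pshiftB y g h : 0 <= y -> is_bounded g -> is_bounded h ->
  pshift y (fun m => g m - h m) = (fun m => pshift y g m - pshift y h m).
Proof.
by move=> y0 bg bh; apply/funext => m; rewrite /pshift meanB//;
  [exact: pois_law|exact: is_bounded_shift..].
Qed.

Lemma pshiftZ y a g : 0 <= y -> is_bounded g ->
  pshift y (fun m => a * g m) = (fun m => a * pshift y g m).
Proof.
by move=> y0 bg; apply/funext => m; rewrite /pshift meanZ//;
  [exact: pois_law|exact: is_bounded_shift].
Qed.

Lemma pshift_succ y g m : pshift y (fun i => g i.+1) m = pshift y g m.+1.
Proof. by apply: eq_mean => i /=; rewrite addSn. Qed.

Lemma pshift0 g : pshift 0 g = g.
Proof.
apply/funext => m; apply: mean_eq; rewrite -(cvg_shiftS (series _)) /=.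
rewrite (_ : (fun n => _) = fun=> g m); first exact: cvg_cst.
apply/funext => n; rewrite /series/= big_nat_recl// pois0 mul1r addn0.
by rewrite big1 ?addr0// => i _; rewrite pois0 mul0r.
Qed.

(** Apply [pois_stein] to the shifted [f] and split [m + i]. *)
Lemma pshift_stein y f m : 0 <= y -> is_bounded f ->
  is_bounded (fun i => i%:R * f i) ->
  pshift y (fun i => i%:R * f i) m =
    m%:R * pshift y f m + y * pshift y (fun i => f i.+1) m.
Proof.
move=> y0 bf bXf; have py := pois_law y0.
have := mean_cvg py (is_bounded_shift m (is_bounded_comp succn bf)).
under [X in series X]eq_fun do rewrite -addnS.
move/(@pois_stein y (fun i => f (m + i)%N)) => c1.
have c2 := mean_cvg py (is_boundedZ m%:R (is_bounded_shift m bf)).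
rewrite meanZ// in c2; last exact: is_bounded_shift.
apply: mean_eq; rewrite (_ : series _ =
  series (fun i => pois y i * (m%:R * f (m + i)%N)) +
  series (fun i => pois y i * (i%:R * f (m + i)%N))); first exact: cvgD c2 c1.
rewrite -seriesD; congr series; apply/funext => i.
by rewrite fctE natrD; ring.
Qed.

(** Stated on consecutive terms, so that a bound on second differences is a
    [lip] bound on the sequence of first differences. *)
Definition lip (L : R) g := forall m, `|g m.+1 - g m| <= L.

Lemma lip_ge0 L g : lip L g -> 0 <= L.
Proof. by move=> /(_ 0%N); apply: le_trans. Qed.

Lemma pshift_lip y L g : 0 <= y -> is_bounded g -> lip L g -> lip L (pshift y g).
Proof.
move=> y0 bg Lg m; rewrite -pshift_succ.
have := pshift_norm y0 Lg m; rewrite pshiftB//; exact: (is_bounded_comp succn).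
Qed.

Lemma lip_dist L g m i : lip L g -> `|g (m + i)%N - g m| <= i%:R * L.
Proof.
move=> Lg; elim: i => [|i ih]; first by rewrite addn0 subrr normr0 mul0r.
rewrite addnS -[X in `|X|](subrKA (g (m + i)%N)).
apply: (le_trans (ler_normD _ _)); rewrite -natr1 mulrDl mul1r addrC.
by apply: lerD.
Qed.

(** Summing [lip_dist] for the first differences: the coefficient
    [i (i - 1) / 2] makes the second factorial moment of the Poisson law appear. *)
Lemma taylor_dist L g m i : lip L (fun j => g j.+1 - g j) ->
  `|g (m + i)%N - g m - i%:R * (g m.+1 - g m)| <= L / 2 * (i%:R * (i%:R - 1)).
Proof.
move=> Lg; elim: i => [|i ih].
  by rewrite addn0 subrr mul0r subrr normr0 mul0r mulr0.
have /= := lip_dist m i Lg; move: ih; rewrite addnS -[i.+1%:R]natr1 !ler_norml.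
by move=> /andP[ih1 ih2] /andP[d1 d2]; apply/andP; split; lra.
Qed.

Lemma mean_norm_cvg (p g u : nat -> R) (l : R) : is_law p -> is_bounded g ->
  (forall i, `|g i| <= u i) -> series (fun i => p i * u i) @ \oo --> l ->
  `|mean p g| <= l.
Proof.
move=> lp bg gu ul; have cg := mean_cvg lp bg.
apply: (ler_cvg_to (cvg_norm cg) ul); apply: nearW => n.
apply: (le_trans (ler_norm_sum _ _ _)); apply: ler_sum => i _.
by rewrite normrM (ger0_norm (lp.1 i)) ler_wpM2l//; exact: lp.1.
Qed.

(** The mean of the Poisson law is [y]. *)
Lemma pshift_near y L g m : 0 <= y -> is_bounded g -> lip L g ->
  `|pshift y g m - g m| <= y * L.
Proof.
move=> y0 bg Lg; have py := pois_law y0.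
rewrite -[X in _ - X](mean_cst _ py) -meanB//;
  [|exact: is_bounded_shift|exact: is_bounded_cst].
apply: (@mean_norm_cvg _ _ (fun i => i%:R * L)) => //.
- by apply: is_boundedB; [exact: is_bounded_shift|exact: is_bounded_cst].
- by move=> i; exact: lip_dist.
rewrite (_ : series _ = fun n => series (fun i => pois y i * i%:R) n * L).
  by apply: cvgMr_tmp; exact: pois_mean.
by apply/funext => n; rewrite /series/= mulr_suml; apply: eq_bigr => i _;
  rewrite mulrA.
Qed.

Lemma is_bounded_diff g : is_bounded g -> is_bounded (fun m => g m.+1 - g m).
Proof.
by move=> bg; apply: is_boundedB => //; exact: (is_bounded_comp succn).
Qed.

(** The factorial moment [E N (N - 1)] is [y ^ 2]. *)
Lemma pshift_taylor y L g m : 0 <= y -> is_bounded g ->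
  lip L (fun j => g j.+1 - g j) ->
  `|pshift y g m - g m - y * (g m.+1 - g m)| <= L / 2 * y ^+ 2.
Proof.
move=> y0 bg Lg; have py := pois_law y0.
have c1 := mean_cvg py (is_boundedB (is_bounded_shift m bg) (is_bounded_cst (g m))).
rewrite meanB// ?mean_cst// in c1; [|exact: is_bounded_shift|exact: is_bounded_cst].
have c2 : series (fun i => pois y i * i%:R) n * (g m.+1 - g m) @[n --> \oo] -->
  y * (g m.+1 - g m) by apply: cvgMr_tmp; exact: pois_mean.
have c3 : L / 2 * series (fun i => pois y i * (i%:R * (i%:R - 1))) n @[n --> \oo]
  --> L / 2 * y ^+ 2 by apply: cvgMl_tmp; exact: pois_mean2.
apply: (ler_cvg_to (cvg_norm (cvgB c1 c2)) c3); apply: nearW => n /=.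
rewrite ?fctE ?opprfctE /series/= mulr_suml mulr_sumr -sumrB.
apply: (le_trans (ler_norm_sum _ _ _)); apply: ler_sum => i _.
rewrite -[X in _ - X]mulrA -mulrBr normrM (ger0_norm (pois_ge0 _ y0)) mulrCA ler_wpM2l ?pois_ge0//.
exact: taylor_dist.
Qed.

End Poisson.

(** * The translation operator of a sum of Bernoulli times Poisson variables *)

Section Operators.
Context {R : realType}.
Implicit Types (g h f : nat -> R) (a b y p : R).

Lemma pshift_comp a b g : 0 <= a -> 0 <= b -> is_bounded g ->
  pshift a (pshift b g) = pshift (a + b) g.
Proof.
move=> a0 b0 bg; apply/funext => m; rewrite /pshift -pois_conv.
rewrite mean_conv//; [|exact: pois_law..|exact: is_bounded_shift].
by apply: eq_mean => i; apply: eq_mean => j; rewrite addnA.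
Qed.

Lemma pshift_comm a b g : 0 <= a -> 0 <= b -> is_bounded g ->
  pshift a (pshift b g) = pshift b (pshift a g).
Proof. by move=> a0 b0 bg; rewrite !pshift_comp// addrC. Qed.

(** The mean of [g (m + B * N)] for independent [B] Bernoulli of mean [p] and
    [N] Poisson of mean [b]. *)
Definition bpshift p b g (m : nat) : R := (1 - p) * g m + p * pshift b g m.

Section Single.
Variables (p b : R).
Hypotheses (p01 : 0 <= p <= 1) (b0 : 0 <= b).

Lemma bpshift_norm g C : (forall m, `|g m| <= C) -> forall m, `|bpshift p b g m| <= C.
Proof.
move=> gC m; have /andP[p0 p1] := p01.
have := pshift_norm b0 gC m; have := gC m; rewrite /bpshift !ler_norml.
by move=> /andP[? ?] /andP[? ?]; apply/andP; split; nra.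
Qed.

Lemma bpshift_bounded g : is_bounded g -> is_bounded (bpshift p b g).
Proof. by move=> [C gC]; exists C; exact: bpshift_norm. Qed.

Lemma bpshiftD g h : is_bounded g -> is_bounded h ->
  bpshift p b (fun m => g m + h m) = (fun m => bpshift p b g m + bpshift p b h m).
Proof.
by move=> bg bh; apply/funext => m; rewrite /bpshift pshiftD//; ring.
Qed.

Lemma bpshiftB g h : is_bounded g -> is_bounded h ->
  bpshift p b (fun m => g m - h m) = (fun m => bpshift p b g m - bpshift p b h m).
Proof.
by move=> bg bh; apply/funext => m; rewrite /bpshift pshiftB//; ring.
Qed.

Lemma bpshiftZ a g : is_bounded g ->
  bpshift p b (fun m => a * g m) = (fun m => a * bpshift p b g m).
Proof. by move=> bg; apply/funext => m; rewrite /bpshift pshiftZ//; ring. Qed.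

Lemma bpshift_succ g m : bpshift p b (fun i => g i.+1) m = bpshift p b g m.+1.
Proof. by rewrite /bpshift pshift_succ. Qed.

Lemma bpshift_lip L g : is_bounded g -> lip L g -> lip L (bpshift p b g).
Proof.
move=> bg Lg m; rewrite -bpshift_succ.
have := bpshift_norm Lg m; rewrite bpshiftB//; exact: (is_bounded_comp succn).
Qed.

Lemma bpshift_near L g m : is_bounded g -> lip L g -> `|bpshift p b g m - g m| <=
  p * b * L.
Proof.
move=> bg Lg; rewrite /bpshift.
rewrite (_ : _ - g m = p * (pshift b g m - g m)); last by ring.
by move: p01 => /andP[p0 _]; rewrite normrM ger0_norm// -mulrA ler_wpM2l//
  pshift_near.
Qed.

Lemma bpshift_pshift_comm a g : 0 <= a -> is_bounded g ->
  bpshift p b (pshift a g) = pshift a (bpshift p b g).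
Proof.
move=> a0 bg; apply/funext => m.
have bPg := pshift_bounded b0 bg.
have := @pshiftD _ a (fun m => (1 - p) * g m) (fun m => p * pshift b g m) a0
  (is_boundedZ _ bg) (is_boundedZ _ bPg).
move=> /(congr1 (fun u => u m)); rewrite -/(bpshift p b g) => ->.
by rewrite (pshiftZ _ a0 bg) (pshiftZ _ a0 bPg) (pshift_comm a0 b0 bg).
Qed.

(** The variable [B N] vanishes with [B], so only the Poisson part is size
    biased; in the application [p * b] is the same for all summands. *)
Lemma bpshift_stein f m : is_bounded f -> is_bounded (fun i => i%:R * f i) ->
  bpshift p b (fun i => i%:R * f i) m =
  m%:R * bpshift p b f m + p * b * pshift b (fun i => f i.+1) m.
Proof. by move=> bf bXf; rewrite /bpshift pshift_stein//; ring. Qed.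

End Single.

Section Iterated.
Variables (p b : nat -> R) (d : R).
Hypotheses (p01 : forall k, 0 <= p k <= 1) (b0 : forall k, 0 <= b k).
Hypothesis pbd : forall k, p k * b k = d.

(** The mean of [g (m + W)] for a sum [W] of [n] independent variables as in
    [bpshift].  Independence of the summands becomes composition of
    operators, and the summands can be taken in any order because translations
    commute. *)
Fixpoint sumshift (n : nat) g : nat -> R :=
  if n is n'.+1 then sumshift n' (bpshift (p n') (b n') g) else g.

Lemma sumshift_norm n g C : (forall m, `|g m| <= C) ->
  forall m, `|sumshift n g m| <= C.
Proof. by elim: n g => //= n ih g gC; apply: ih; exact: bpshift_norm. Qed.

Lemma sumshiftD n g h : is_bounded g -> is_bounded h ->
  sumshift n (fun m => g m + h m) = (fun m => sumshift n g m + sumshift n h m).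
Proof.
elim: n g h => //= n ih g h bg bh; rewrite bpshiftD// ih//; exact: bpshift_bounded.
Qed.

Lemma sumshiftB n g h : is_bounded g -> is_bounded h ->
  sumshift n (fun m => g m - h m) = (fun m => sumshift n g m - sumshift n h m).
Proof.
elim: n g h => //= n ih g h bg bh; rewrite bpshiftB// ih//; exact: bpshift_bounded.
Qed.

Lemma sumshiftZ n a g : is_bounded g -> sumshift n (fun m => a * g m) =
  (fun m => a * sumshift n g m).
Proof.
elim: n g => //= n ih g bg; rewrite bpshiftZ// ih//; exact: bpshift_bounded.
Qed.

Lemma sumshift_near n L g m : is_bounded g -> lip L g ->
  `|sumshift n g m - g m| <= n%:R * (d * L).
Proof.
elim: n g => [|n ih] g bg Lg /=; first by rewrite subrr normr0 mul0r.
have := ih _ (bpshift_bounded (p01 n) (b0 n) bg) (bpshift_lip (p01 n) (b0 n) bg Lg).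
have := bpshift_near (p01 n) (b0 n) m bg Lg; rewrite pbd -[n.+1%:R]natr1 !ler_norml.
by move=> /andP[? ?] /andP[? ?]; apply/andP; split; lra.
Qed.

Lemma sumshift_close n g h e : is_bounded g -> is_bounded h ->
  (forall m, `|g m - h m| <= e) ->
  forall m, `|sumshift n g m - sumshift n h m| <= e.
Proof.
by move=> bg bh gh m; have := sumshift_norm n gh m; rewrite sumshiftB.
Qed.

(** Size biasing the sum size biases one summand, chosen in turn:
    [E W f(W) = d * sum_l E f (W_l + N_(b l) + 1)] with [W_l] the sum without its
    summand of index [l].  Putting that summand back moves the argument by
    [d] on average, hence the error [d * d * L] for each of the [n] terms.  The
    hypothesis that [i * f i] is bounded is preserved by the induction, since
    [bpshift_stein] expresses [i * bpshift f i] through bounded sequences. *)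
Lemma sumshift_size_bias n f L m : 0 <= d -> is_bounded f ->
  is_bounded (fun i => i%:R * f i) ->
  lip L (fun i => f i.+1) ->
  `|sumshift n (fun i => i%:R * f i) m - m%:R * sumshift n f m
    - d * \sum_(l < n) sumshift n (pshift (b l) (fun i => f i.+1)) m| <=
      n%:R * (d ^+ 2 * L).
Proof.
move=> d0; elim: n f => [|n ih] f bf bXf Lf /=.
  by rewrite big_ord0 mulr0 subrr subr0 normr0 mul0r.
set S := bpshift (p n) (b n); have pn := p01 n; have bn := b0 n.
have bsf : is_bounded (fun i => f i.+1) := is_bounded_comp succn bf.
have bSf : is_bounded (S f) by exact: bpshift_bounded.
have bPf : is_bounded (pshift (b n) (fun i => f i.+1)) by exact: pshift_bounded.
have E : (fun i => i%:R * S f i) =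
    (fun i => S (fun i => i%:R * f i) i - d * pshift (b n) (fun i => f i.+1) i).
  by apply/funext => i; rewrite /S bpshift_stein// pbd addrK.
have bXSf : is_bounded (fun i => i%:R * S f i).
  by rewrite E; apply: is_boundedB; [exact: bpshift_bounded|exact: is_boundedZ].
have Ssf : (fun i => S f i.+1) = S (fun i => f i.+1).
  by apply/funext => i; rewrite /S bpshift_succ.
have LSf : lip L (fun i => S f i.+1) by rewrite Ssf; exact: bpshift_lip.
have := ih _ bSf bXSf LSf; rewrite E sumshiftB ?sumshiftZ//; last 2 first.
- exact: bpshift_bounded.
- exact: is_boundedZ.
have -> : \sum_(l < n) sumshift n (pshift (b l) (fun i => S f i.+1)) m =
    \sum_(l < n) sumshift n (S (pshift (b l) (fun i => f i.+1))) m.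
  by apply: eq_bigr => l _; rewrite Ssf /S bpshift_pshift_comm.
rewrite big_ord_recr/= -/S -[n.+1%:R]natr1.
have := sumshift_close n (bpshift_bounded pn bn bPf) bPf
  (fun m => bpshift_near pn bn m bPf (pshift_lip bn bsf Lf)) m.
rewrite pbd -/S !ler_norml => /andP[h1 h2] /andP[h3 h4].
by apply/andP; split; nra.
Qed.

Hypothesis bE : forall k, b k = d * k.+1%:R.

(** The translation by [N_(d n)] is done in [n] steps of mean [d].  In each
    step [pshift_taylor] costs [L d^2 / 2], and replacing the first
    difference at the beginning of the step by its value at the end costs
    [L d^2]. *)
Lemma sumshift_pshift n g L m : 0 <= d -> is_bounded g ->
  lip L (fun i => g i.+1 - g i) ->
  `|sumshift n (pshift (d * n%:R) g) m - sumshift n g m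
    - d * \sum_(l < n) sumshift n (pshift (b l) (fun i => g i.+1 - g i)) m|
  <= n%:R * (3 / 2 * d ^+ 2 * L).
Proof.
move=> d0 bg Lg; have dn k : 0 <= d * k%:R by rewrite mulr_ge0.
have bDg := is_bounded_diff bg.
suff: forall k, `|sumshift n (pshift (d * k%:R) g) m - sumshift n g m
    - d * \sum_(l < k) sumshift n (pshift (b l) (fun i => g i.+1 - g i)) m|
  <= k%:R * (3 / 2 * d ^+ 2 * L) by exact.
elim=> [|k ih].
  by rewrite mulr0 pshift0 big_ord0 mulr0 subrr subr0 normr0 mul0r.
rewrite big_ord_recr/=.
have bb : b k = d * k%:R + d by rewrite bE -natr1 mulrDr mulr1.
have E : pshift (d * k.+1%:R) g = pshift (d * k%:R) (pshift d g).
  by rewrite pshift_comp// -natr1 mulrDr mulr1.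
have E' : pshift (b k) (fun i => g i.+1 - g i) =
    pshift (d * k%:R) (pshift d (fun i => g i.+1 - g i)).
  by rewrite pshift_comp// bb.
have step i : `|pshift d g i - (g i + d * pshift d (fun i => g i.+1 - g i) i)|
    <= 3 / 2 * d ^+ 2 * L.
  have := pshift_taylor i d0 bg Lg; have := pshift_near i d0 bDg Lg.
  rewrite !ler_norml => /andP[h1 h2] /andP[h3 h4].
  by apply/andP; split; nra.
have bPg := pshift_bounded d0 bg; have bPD := pshift_bounded d0 bDg.
have bgd : is_bounded (fun i => g i + d * pshift d (fun i => g i.+1 - g i) i).
  by apply: is_boundedD => //; exact: is_boundedZ.
have step2 i : `|pshift (d * k%:R) (pshift d g) i - (pshift (d * k%:R) g i +
    d * pshift (d * k%:R) (pshift d (fun i => g i.+1 - g i)) i)| <=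
      3 / 2 * d ^+ 2 * L.
  have := pshift_norm (dn k) step i.
  by rewrite pshiftB// pshiftD ?pshiftZ//; exact: is_boundedZ.
have := sumshift_close n (pshift_bounded (dn k) bPg) _ step2 m.
rewrite sumshiftD ?sumshiftZ//; [|exact: pshift_bounded|exact:
  pshift_bounded|by apply: is_boundedZ; exact: pshift_bounded].
move=> /(_ _)/wrap[]; first by apply: is_boundedD; [|apply: is_boundedZ];
  exact: pshift_bounded.
rewrite E -E' => {}step2; move: ih step2; rewrite -[k.+1%:R]natr1 !ler_norml.
by move=> /andP[h1 h2] /andP[h3 h4]; apply/andP; split; lra.
Qed.

End Iterated.
End Operators.

(** * Averaging, and the comparison with a fixed point *)

Section Average.
Context {R : realType}.
Implicit Types (g h f : nat -> R).

Definition avg h (m : nat) : R := (\sum_(i < m.+1) h i) / m.+1%:R.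

(** At [m = 0] the value only occurs multiplied by [0]; the choice of [0]
    starts the induction of [avg_lip]. *)
Definition davg h (m : nat) : R := if m is j.+1 then avg h j.+1 - avg h j else 0.

Lemma avg_norm h C : (forall m, `|h m| <= C) -> forall m, `|avg h m| <= C.
Proof.
move=> hC m; rewrite /avg normrM normfV (@ger0_norm _ m.+1%:R)// ler_pdivrMr//.
apply: (le_trans (ler_norm_sum _ _ _)).
apply: (@le_trans _ _ (\sum_(i < m.+1) C)); first by apply: ler_sum.
by rewrite sumr_const card_ord mulr_natr.
Qed.

Lemma avg_bounded h : is_bounded h -> is_bounded (avg h).
Proof. by move=> [C hC]; exists C; exact: avg_norm. Qed.

Lemma avg_davg h m : h m = avg h m + m%:R * davg h m.
Proof.
case: m => [|m]; first by rewrite /avg big_ord1 divr1 mul0r addr0.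
rewrite /davg /avg [X in X / m.+2%:R]big_ord_recr /=.
set s := \sum_(i < m.+1) _.
have m1 : m.+1%:R != 0 :> R by rewrite pnatr_eq0.
have m2 : m.+2%:R != 0 :> R by rewrite pnatr_eq0.
have E : m.+2%:R = m.+1%:R + 1 :> R by rewrite natr1.
rewrite E in m2 *; move: (m.+1%:R) m1 m2 => x m1 m2; field; rewrite ?m1 ?m2 //.
Qed.

Lemma davg_rec h m :
  (m.+2)%:R * davg h m.+1 = (h m.+1 - h m) + m%:R * davg h m.
Proof.
have -> : m.+2%:R = m.+1%:R + 1 :> R by rewrite natr1.
rewrite [h m.+1 in RHS]avg_davg [h m in RHS]avg_davg [davg h m.+1]/davg; ring.
Qed.

(** The difference of two instances of [davg_rec].  The second difference
    of the average is a combination, with weights [m / (m + 3)] and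
    [1 / (m + 3)], of the previous one and of a second difference of [h]. *)
Lemma davg_rec2 h m : (m.+3)%:R * (davg h m.+2 - davg h m.+1) =
  ((h m.+2 - h m.+1) - (h m.+1 - h m)) + m%:R * (davg h m.+1 - davg h m).
Proof.
have := davg_rec h m; have := davg_rec h m.+1.
have -> : m.+3%:R = m%:R + 3 :> R by rewrite -addn3 natrD.
have -> : m.+2%:R = m%:R + 2 :> R by rewrite -addn2 natrD.
have -> : m.+1%:R = m%:R + 1 :> R by rewrite -addn1 natrD.
lra.
Qed.

(** By [davg_rec] and induction: the bound [L / 2] satisfies
    [(m + 2) (L / 2) = L + m (L / 2)]. *)
Lemma avg_lip L h : lip L h -> lip (L / 2) (avg h).
Proof.
move=> Lh; have L0 := lip_ge0 Lh.
suff H m : `|davg h m| <= L / 2 by move=> m; exact: (H m.+1).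
elim: m => [|m ih]; first by rewrite normr0 divr_ge0.
have := davg_rec h m; have := Lh m; move: ih.
have -> : m.+2%:R = m%:R + 2 :> R by rewrite -addn2 natrD.
have m0 : 0 <= m%:R :> R by [].
move: (davg h m) (davg h m.+1) (h m.+1 - h m) (m%:R) m0 => x y z a a0.
rewrite !ler_norml => /andP[x1 x2] /andP[z1 z2] E.
by apply/andP; split; nra.
Qed.

(** By [davg_rec2] and induction: the bound [L / 3] satisfies
    [(m + 3) (L / 3) = L + m (L / 3)]. *)
Lemma davg_lip L h : lip L (fun i => h i.+1 - h i) ->
  lip (L / 3) (fun i => davg h i.+1).
Proof.
move=> Lh; have L0 := lip_ge0 Lh.
have aux m x y z a : a = m%:R :> R -> `|z| <= L -> `|x| <= L / 3 ->
    m.+3%:R * y = z + m%:R * x -> `|y| <= L / 3.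
  move=> aE; have -> : m.+3%:R = m%:R + 3 :> R by rewrite -addn3 natrD.
  have : 0 <= m%:R :> R by [].
  rewrite -aE => a0 {aE}; rewrite !ler_norml => /andP[z1 z2] /andP[x1 x2] E.
  by apply/andP; split; nra.
elim=> [|m ih].
  apply: (@aux 0%N 0 _ _ 0 erefl (Lh 0%N)); first by rewrite normr0 divr_ge0.
  by rewrite (davg_rec2 h 0) !mul0r.
by apply: (@aux m.+1 _ _ _ _ erefl (Lh m.+1) ih); rewrite (davg_rec2 h m.+1).
Qed.

Variable c : R.
Hypothesis c0 : 0 <= c.

(** The transition [K]: add a Poisson variable of mean [c], then choose
    uniformly between [0] and the result. *)
Definition kstep h : nat -> R := pshift c (avg h).

Lemma kstep_norm h C : (forall m, `|h m| <= C) -> forall m, `|kstep h m| <= C.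
Proof. by move=> /avg_norm; exact: pshift_norm. Qed.

Lemma kstep_bounded h : is_bounded h -> is_bounded (kstep h).
Proof. by move=> [C hC]; exists C; exact: kstep_norm. Qed.

Lemma kstep_lip L h : is_bounded h -> lip L h -> lip (L / 2) (kstep h).
Proof.
by move=> bh Lh; apply: pshift_lip => //; [exact: avg_bounded|exact: avg_lip].
Qed.

Lemma kstep_lip2 L h : is_bounded h -> lip L (fun i => h i.+1 - h i) ->
  lip (L / 3) (fun i => kstep h i.+1 - kstep h i).
Proof.
move=> bh Lh; have ba := avg_bounded bh.
rewrite (_ : (fun i => _) = pshift c (fun i => davg h i.+1)).
  by apply: pshift_lip => //; [exact: is_bounded_diff|exact: davg_lip].
apply/funext => i; rewrite /kstep -pshift_succ.
by rewrite /davg pshiftB//; exact: (is_bounded_comp succn).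
Qed.

Variables (p b : nat -> R) (d : R) (n : nat).
Hypotheses (p01 : forall k, 0 <= p k <= 1) (d0 : 0 <= d).
Hypothesis pbd : forall k, p k * b k = d.
Hypothesis bE : forall k, b k = d * k.+1%:R.
Hypothesis cE : c = d * n%:R.

Let b0 k : 0 <= b k. Proof. by rewrite bE mulr_ge0. Qed.

(** With [h = avg h + m * davg h], [sumshift_size_bias] applied to [davg h] and
    [sumshift_pshift] applied to [avg h] have the same main term.  The errors add to
    [(1 + 3/2) n d^2 (L / 3)]. *)
Lemma sumshift_kstep h L : is_bounded h -> lip L (fun i => h i.+1 - h i) ->
  `|sumshift p b n h 0 - sumshift p b n (kstep h) 0| <= 5 / 6 * (n%:R * d ^+ 2) * L.
Proof.
move=> bh Lh; have ba := avg_bounded bh.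
have E : (fun m => m%:R * davg h m) = (fun m => h m - avg h m).
  by apply/funext => m; rewrite [h m]avg_davg addrAC subrr add0r.
have bX : is_bounded (fun m => m%:R * davg h m) by rewrite E; exact: is_boundedB.
have bd : is_bounded (davg h).
  have [C gC] := is_bounded_diff ba; exists C; case=> [|m]; last exact: gC.
  by rewrite normr0 (le_trans _ (gC 0%N)).
have Ld := davg_lip Lh.
have := sumshift_size_bias p01 b0 pbd n 0 d0 bd bX Ld.
have := sumshift_pshift p01 b0 bE n 0 d0 ba Ld.
rewrite E sumshiftB// -cE mul0r subr0 -/(kstep h) !ler_norml.
move=> /andP[h1 h2] /andP[h3 h4]; apply/andP.
by split; lra.
Qed.

(** The bound is the fixed point of [s = 5/6 + s / 3]: one step costs [5/6]
    and the next starts from second differences three times smaller. *)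
Lemma sumshift_kstep_iter N h L : is_bounded h -> lip L (fun i => h i.+1 - h i) ->
  `|sumshift p b n h 0 - sumshift p b n (iter N kstep h) 0| <=
    5 / 4 * (n%:R * d ^+ 2) * L.
Proof.
have nd : 0 <= n%:R * d ^+ 2 by rewrite mulr_ge0// sqr_ge0.
elim: N h L => [|N ih] h L bh Lh.
  by rewrite subrr normr0 mulr_ge0 ?(lip_ge0 Lh)// mulr_ge0// divr_ge0.
have := sumshift_kstep bh Lh; have := ih _ _ (kstep_bounded bh) (kstep_lip2 bh Lh).
rewrite iterSr !ler_norml => /andP[? ?] /andP[? ?].
by apply/andP; split; lra.
Qed.

Lemma iter_kstep_bounded N h : is_bounded h -> is_bounded (iter N kstep h).
Proof. by move=> bh; elim: N => //= N ih; exact: kstep_bounded. Qed.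

Lemma iter_kstep_lip N h L : is_bounded h -> lip L h ->
  lip (L * 2^-1 ^+ N) (iter N kstep h).
Proof.
move=> bh Lh; elim: N => [|N ih] /=; first by rewrite expr0 mulr1.
by rewrite exprSr mulrA; apply: kstep_lip => //; exact: iter_kstep_bounded.
Qed.

Lemma iter_kstep_norm N h C : (forall m, `|h m| <= C) ->
  forall m, `|iter N kstep h m| <= C.
Proof. by move=> hC; elim: N => //= N ih; exact: kstep_norm. Qed.

(** Below [J] the increments of [g] control the difference, and the mass
    above [J] is what remains of the total mass [1]. *)
Lemma mean_near0 z g L J : is_law z -> (forall m, `|g m| <= 1) -> lip L g ->
  `|mean z g - g 0%N| <= J%:R * L + 2 * (1 - series z J).
Proof.
move=> lz g1 Lg; have L0 := lip_ge0 Lg; have [z0 z1] := lz.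
have bg : is_bounded g by exists 1.
have bgB : is_bounded (fun i => g i - g 0%N) by apply: is_boundedB => //;
  exact: is_bounded_cst.
rewrite -[X in _ - X](mean_cst _ lz) -meanB//; last exact: is_bounded_cst.
have nd := @nondecreasing_series _ z xpredT 0%N (fun i _ _ => z0 i).
have sle k : series z k <= 1.
  by rewrite -(cvg_lim _ z1)//; apply: nondecreasing_cvgn_le => //; exact: cvgP z1.
apply: (ler_cvg_to (cvg_norm (mean_cvg lz bgB)) (@cvg_cst _ _ _ _ _)).
near=> N; have JN : (J <= N)%N by near: N; exact: nbhs_infty_ge.
rewrite /series/= (big_cat_nat (leq0n J) JN)//=.
apply: (le_trans (ler_normD _ _)); apply: lerD.
  apply: (@le_trans _ _ (\sum_(0 <= i < J) z i * (J%:R * L))).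
    apply: (le_trans (ler_norm_sum _ _ _)).
    rewrite big_nat_cond [leRHS]big_nat_cond;
      apply: ler_sum => i /andP[/andP[_ iJ] _].
    rewrite normrM (ger0_norm (z0 i)) ler_wpM2l//.
    have := lip_dist 0 i Lg; rewrite add0n => /le_trans; apply.
    by rewrite ler_wpM2r// ler_nat ltnW.
  by rewrite -mulr_suml ler_piMl ?mulr_ge0//; exact: sle.
apply: (@le_trans _ _ (\sum_(J <= i < N) z i * 2)).
  apply: (le_trans (ler_norm_sum _ _ _)); apply: ler_sum => i _.
  rewrite normrM (ger0_norm (z0 i)) ler_wpM2l//.
  by apply: (le_trans (ler_normB _ _)); have := g1 i; have := g1 0%N; lra.
rewrite -mulr_suml mulrC ler_wpM2l//.
by have := sle N; rewrite /series/= (big_cat_nat (leq0n J) JN)//=; lra.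
Unshelve. all: by end_near. Qed.

Lemma cvg_half_pow (a : R) : a * 2^-1 ^+ N @[N --> \oo] --> 0.
Proof.
by apply: (@cvg_geometric R a 2^-1); rewrite ger0_norm ?invf_lt1 ?ltr1n// invr_ge0.
Qed.

(** The law [z] does not distinguish [h] from its iterates, while the sum
    distinguishes them by the bound of [sumshift_kstep_iter]; a far iterate is
    almost constant for both. *)
Lemma sumshift_fixed_point_dist z h : is_law z ->
  (forall g, is_bounded g -> mean z (kstep g) = mean z g) ->
  (forall m, 0 <= h m <= 1) ->
  `|sumshift p b n h 0 - mean z h| <= 5 / 2 * (n%:R * d ^+ 2).
Proof.
move=> lz zK h01.
have h1 m : `|h m| <= 1 by have /andP[? ?] := h01 m; rewrite ger0_norm.
have bh : is_bounded h by exists 1.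
have L1 : lip 1 h.
  move=> m; have /andP[? ?] := h01 m; have /andP[? ?] := h01 m.+1.
  by rewrite ler_norml; apply/andP; split; lra.
have L2 : lip 2 (fun i => h i.+1 - h i).
  move=> m; have /andP[? ?] := h01 m; have /andP[? ?] := h01 m.+1.
  have /andP[? ?] := h01 m.+2.
  by rewrite ler_norml; apply/andP; split; lra.
apply/ler_addgt0Pr => /= e e0.
(* both error terms of the last iterate are made smaller than [e / 2] *)
have [J HJ] : exists J, 2 * (1 - series z J) < e / 2.
  have : 1 - series z k @[k --> \oo] --> 1 - (1 : R).
    by apply: cvgB; [exact: cvg_cst|exact: lz.2].
  rewrite subrr => /cvgr_lt/(_ _ (divr_gt0 e0 (ltr0n _ 4))).
  by case=> J _ /(_ J (leqnn J)) /= ?; exists J; lra.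
have [N HN] : exists N, (J%:R + n%:R * d) * 2^-1 ^+ N < e / 2.
  have /cvgr_lt/(_ _ (divr_gt0 e0 (ltr0n _ 2))) := cvg_half_pow (J%:R + n%:R * d).
  by case=> N _ /(_ N (leqnn N)) /= ?; exists N.
have zN : mean z (iter N kstep h) = mean z h.
  by elim: (N) => //= k <-; rewrite zK//; exact: iter_kstep_bounded.
have lN := iter_kstep_lip N bh L1.
have := sumshift_kstep_iter N bh L2.
have := sumshift_near p01 b0 pbd n 0 (iter_kstep_bounded N bh) lN.
have := mean_near0 J lz (iter_kstep_norm N h1) lN.
rewrite zN mul1r !ler_norml => /andP[? ?] /andP[? ?] /andP[? ?].
by apply/andP; split; lra.
Qed.

End Average.

(** * Laws of integer variables and of independent families *)

Section DiscreteLaw.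
Context {R : realType} d (T : measurableType d) (P : probability T R).

Lemma prob_discrete (X : T -> nat) (w : nat -> R) :
  (forall j, measurable [set t | X t = j]) ->
  (forall j, P [set t | X t = j] = (w j)%:E) ->
  is_law w /\ forall A : set nat,
    P (X @^-1` A) = (mean w (fun j => (j \in A)%:R))%:E.
Proof.
move=> mX wE; have w0 j : 0 <= w j by rewrite -lee_fin -wE measure_ge0.
have main (A : set nat) :
    series (fun j => w j * (j \in A)%:R) @ \oo --> fine (P (X @^-1` A)).
  apply: cvg_series_nneseries => [j|]; first by rewrite mulr_ge0.
  rewrite fineK ?fin_num_measure//; last first.
    rewrite (_ : _ @^-1` _ = \bigcup_(j in A) [set t | X t = j]).
      by apply: bigcup_measurable.
    by apply/seteqP; split=> [t At|t [j Aj /= Xj]]; [exists (X t)|rewrite /= Xj].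
  rewrite (_ : X @^-1` A = \bigcup_(j in A) [set t | X t = j]); last first.
    by apply/seteqP; split=> [t At|t [j Aj /= Xj]]; [exists (X t)|rewrite /= Xj].
  rewrite measure_bigcup//; last by move=> i j _ _ [t [/= Xi Xj]]; rewrite -Xi -Xj.
  rewrite [RHS]eseries_mkcond; apply: eq_eseriesr => j _.
  by case: ifPn => _; rewrite ?mulr1 ?mulr0// -wE.
have lw : is_law w.
  split=> //; have := main setT; rewrite preimage_setT probability_setT.
  by under eq_fun do rewrite in_setT mulr1.
split=> // A; rewrite (mean_eq (main A)) fineK// fin_num_measure//.
rewrite (_ : _ @^-1` _ = \bigcup_(j in A) [set t | X t = j]).
  by apply: bigcup_measurable.
by apply/seteqP; split=> [t At|t [j Aj /= Xj]]; [exists (X t)|rewrite /= Xj].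
Qed.

(** The event is the disjoint union over the value [i] of [X].  The extra
    event [G] carries the independence assumptions of the induction on the number of
    summands. *)
Lemma prob_addn (X V : T -> nat) (G : set T) (x u : nat -> R) (g : R) j :
  (forall i v, measurable ([set t | X t = i] `&` ([set t | V t = v] `&` G)) /\
     P ([set t | X t = i] `&` ([set t | V t = v] `&` G)) = (x i * u v * g)%:E) ->
  measurable ([set t | (X t + V t)%N = j] `&` G) /\
  P ([set t | (X t + V t)%N = j] `&` G) = (conv x u j * g)%:E.
Proof.
move=> H.
pose E (i : 'I_j.+1) := [set t | X t = i] `&` ([set t | V t = (j - i)%N] `&` G).
have EE : [set t | (X t + V t)%N = j] `&` G = \big[setU/set0]_(i < j.+1) E i.
  rewrite -bigcup_mkord_ord; apply/seteqP; split=> t /=.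
    move=> [XV Gt]; have Xj : (X t < j.+1)%N by lia.
    exists (X t) => //; rewrite /E /= inordK//; split=> //; split=> //; lia.
  by move=> [i /= ij]; rewrite /E /= inordK// => -[Xi [Vi Gt]]; split=> //; lia.
have mE i : measurable (E i) by exact: (H _ _).1.
rewrite EE; split; first exact: bigsetU_measurable.
rewrite measure_bigsetU_ord//; last first.
  by move=> i i' _ _ [t [[/= Xi _] [/= Xi' _]]]; apply: val_inj; rewrite /= -Xi -Xi'.
rewrite /conv mulr_suml -sumEFin; apply: eq_bigr => i _.
exact: (H _ _).2.
Qed.

Variables (I : finType) (F : I -> set (set T)).
Hypothesis hF : forall i E, F i E -> measurable E.
Hypothesis hind : independent_systems P F.

Definition cyl (J : {set I}) (A : I -> set T) : set T := \bigcap_(i in [set` J]) A i.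

(** Intersections of events of the systems with indices in [J]; these are
    the events to which [independent_systems] applies. *)
Definition cylinder (J : {set I}) (G : set T) : Prop :=
  exists2 A : I -> set T, (forall i, i \in J -> F i (A i)) & G = cyl J A.

Lemma cylinder_measurable J G : cylinder J G -> measurable G.
Proof.
move=> [A FA ->]; apply: fin_bigcap_measurable => // i iJ; exact/hF/FA.
Qed.

Lemma cylinderU J G i0 E : cylinder J G -> F i0 E -> i0 \notin J ->
  cylinder (i0 |: J) (E `&` G) /\ P (E `&` G) = (P E * P G)%E.
Proof.
move=> [A FA ->] FE iJ; pose A' i := if i == i0 then E else A i.
have A'E : E `&` cyl J A = cyl (i0 |: J) A'.
  apply/seteqP; split=> t.
    move=> [Et At] i /=; rewrite /A' in_setU1; case: eqP => //= _ iJ'.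
    exact: At.
  move=> At; split.
    by have := At i0; rewrite /A' /= setU11 eqxx; apply.
  move=> i /= iJ'; have := At i; rewrite /A' /= in_setU1 iJ' orbT.
  by case: eqP iJ' iJ => [-> ->//|_ _ _]; apply.
have FA' i : i \in i0 |: J -> F i (A' i).
  by rewrite in_setU1 /A'; case: eqP => [->//|_ /=]; exact: FA.
split; first by exists A'.
rewrite A'E /cyl (hind FA') (hind FA) big_setU1//= /A' eqxx; congr (_ * _)%E.
by apply: eq_bigr => i iJ'; case: eqP => // ii0; rewrite -ii0 iJ' in iJ.
Qed.

End DiscreteLaw.

(** * The law of the sum of Bernoulli times Poisson variables *)

Section LawRec.
Context {R : realType}.
Variables (p b : nat -> R).
Hypotheses (p01 : forall k, 0 <= p k <= 1) (b0 : forall k, 0 <= b k).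

Definition bern_pois k (j : nat) : R :=
  (1 - p k) * (j == 0%N)%:R + p k * pois (b k) j.

Lemma bern_pois_series k g : is_bounded g ->
  series (fun j => bern_pois k j * g j) @ \oo --> (1 - p k) * g 0%N + p k * mean (pois (b k)) g.
Proof.
move=> bg; rewrite (_ : series _ =
  (fun N => (1 - p k) * series (fun j => pois 0 j * g j) N) +
  (fun N => p k * series (fun j => pois (b k) j * g j) N)); last first.
  apply/funext => N; rewrite fctE /series/= !mulr_sumr -big_split.
  by apply: eq_bigr => j _; rewrite /bern_pois pois0 /=; ring.
apply: cvgD; apply: cvgMl_tmp; last by apply: mean_cvg => //; exact: pois_law.
(* the point mass at [0] is the Poisson law of mean [0] *)
have -> : g 0%N = pshift 0 g 0 by rewrite pshift0.
by apply: mean_cvg => //; exact: pois_law.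
Qed.

Lemma bern_pois_law k : is_law (bern_pois k).
Proof.
have /andP[p0 p1] := p01 k; split=> [j|].
  by rewrite addr_ge0// mulr_ge0 ?subr_ge0 ?pois_ge0.
have := @bern_pois_series k _ (is_bounded_cst 1); rewrite mean_cst;
  last exact: pois_law.
rewrite !mulr1 subrK; by under eq_fun do rewrite mulr1.
Qed.

Lemma mean_bern_pois k g m : is_bounded g ->
  mean (bern_pois k) (fun j => g (m + j)%N) = bpshift (p k) (b k) g m.
Proof.
by move=> bg; rewrite (mean_eq (@bern_pois_series k _ (is_bounded_shift m bg))) addn0.
Qed.

Fixpoint sum_law k : nat -> R :=
  if k is k'.+1 then conv (sum_law k') (bern_pois k') else pois 0.

Lemma sum_law_is_law k : is_law (sum_law k).
Proof.
elim: k => [|k ih] /=; first exact: pois_law.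
by apply: conv_law => //; exact: bern_pois_law.
Qed.

Lemma mean_sum_law k g : is_bounded g -> mean (sum_law k) g = sumshift p b k g 0.
Proof.
elim: k g => [|k ih] g bg /=.
  by rewrite -[LHS]/(pshift 0 g 0%N) pshift0.
rewrite (mean_conv (sum_law_is_law k) (bern_pois_law k) bg) -ih;
  last exact: bpshift_bounded.
by apply: eq_mean => i; rewrite mean_bern_pois.
Qed.

Context d (T : measurableType d) (P : probability T R) (n : nat).
Variables (B : 'I_n -> {RV P >-> bool}) (Po : 'I_n -> {RV P >-> nat}).
Hypothesis hB : forall k, P [set w | B k w = true] = (p k)%:E.
Hypothesis hPo : forall k j, P [set w | Po k w = j] = (pois (b k) j)%:E.
Let F (i : 'I_n + 'I_n) : set (set T) :=
  match i with inl k => sigma_of (B k) | inr k => sigma_of (Po k) end.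
Hypothesis hind : independent_systems P F.

Let hF i E : F i E -> measurable E.
Proof.
by case: i => k [Y mY <-]; apply: (measurable_funPT _ measurableT).
Qed.

Let FB k e : F (inl k) [set w | B k w = e].
Proof. by exists [set e] => //; rewrite setTI. Qed.

Let FP k v : F (inr k) [set w | Po k w = v].
Proof. by exists [set v] => //; rewrite setTI. Qed.

Let PB k e : P [set w | B k w = e] = (if e then p k else 1 - p k)%:E.
Proof.
case: e => //; rewrite (_ : [set w | _] = ~` [set w | B k w = true]).
  rewrite probability_setC; last by apply: hF; exact: (FB k true).
  by rewrite hB.
by apply/seteqP; split=> w /=; case: (B k w).
Qed.

Let rank (i : 'I_n + 'I_n) : nat := match i with inl k => k | inr k => k end.

Let partial_sum k w : nat := (\sum_(l < n | (l < k)%N) B l w * Po l w)%N.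

(** The value [v] of the product of [B k] and [Po k] determines the event
    in terms of [B k] and [Po k] separately, except that [v = 0] splits into the
    disjoint cases [B k = 0] and [B k = 1, Po k = 0].  Each case is a cylinder on
    indices not below [k], to which the hypothesis on [X] applies. *)
Let step_event (k : 'I_n) (X : T -> nat) (x : nat -> R) J G :
  (forall J' G', cylinder F J' G' -> (forall i, i \in J' -> k <= rank i)%N ->
    forall i, measurable ([set w | X w = i] `&` G') /\
      P ([set w | X w = i] `&` G') = (x i * fine (P G'))%:E) ->
  cylinder F J G -> (forall i, i \in J -> k < rank i)%N ->
  forall i v,
  measurable ([set w | X w = i] `&` ([set w | (B k w * Po k w)%N = v] `&` G)) /\
  P ([set w | X w = i] `&` ([set w | (B k w * Po k w)%N = v] `&` G))
    = (x i * bern_pois k v * fine (P G))%:E.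
Proof.
move=> ih cG kJ i v.
have GE : P G = (fine (P G))%:E.
  by rewrite fineK// fin_num_measure//; exact: cylinder_measurable cG.
have kP : inr k \notin J by apply/negP => /kJ; rewrite /= ltnn.
have kB : inl k \notin J by apply/negP => /kJ; rewrite /= ltnn.
have [cPG PPG] := cylinderU hind cG (FP k v) kP.
have kB' : inl k \notin (inr k |: J) by rewrite in_setU1 negb_or kB.
have [c1 P1] := cylinderU hind cPG (FB k true) kB'.
have [c0 P0] := cylinderU hind cG (FB k false) kB.
have k1 j : j \in inl k |: (inr k |: J) -> (k <= rank j)%N.
  by rewrite !in_setU1 => /or3P[/eqP->|/eqP->|/kJ/ltnW].
have k0 j : j \in inl k |: J -> (k <= rank j)%N.
  by rewrite !in_setU1 => /orP[/eqP->|/kJ/ltnW].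
have [m1 E1] := ih _ _ c1 k1 i; have [m0 E0] := ih _ _ c0 k0 i.
rewrite P1 PPG hPo PB GE -!EFinM /= in E1.
rewrite P0 PB GE -!EFinM /= in E0.
case: v cPG PPG c1 P1 m1 E1 => [|v] cPG PPG c1 P1 m1 E1; last first.
  rewrite (_ : _ `&` G = [set w | B k w = true] `&` ([set w | Po k w = v.+1] `&` G)).
    by split=> //; rewrite E1 /bern_pois mulr0 add0r; congr EFin; ring.
  apply/seteqP; split=> w /=; last by move=> [-> [-> ?]]; rewrite mul1n.
  by case: (B k w); rewrite ?mul1n ?mul0n => -[].
have -> : [set w | X w = i] `&` ([set w | (B k w * Po k w)%N = 0%N] `&` G) =
   ([set w | X w = i] `&` ([set w | B k w = true] `&` ([set w | Po k w = 0%N] `&` G)))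
   `|` ([set w | X w = i] `&` ([set w | B k w = false] `&` G)).
  apply/seteqP; split=> w /=.
    by case: (B k w); rewrite ?mul1n ?mul0n => -[? [? ?]]; [left|right].
  by move=> [[? [-> [-> ?]]]|[? [-> ?]]].
split; first exact: measurableU.
rewrite measureU//; last first.
  by apply/seteqP; split=> // w /= [[_ [-> _]] [_ []]].
apply: (etrans (congr2 adde E1 E0)).
rewrite -[LHS]EFinD /bern_pois eqxx; congr EFin; rewrite /=; ring.
Qed.

(** The induction on [k] needs independence of the partial sum from events
    about the later variables, so it is proved together with the law. *)
Let partial_sum_law k J G : (k <= n)%N -> cylinder F J G ->
  (forall i, i \in J -> k <= rank i)%N ->
  forall i, measurable ([set w | partial_sum k w = i] `&` G) /\
      P ([set w | partial_sum k w = i] `&` G) = (sum_law k i * fine (P G))%:E.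
Proof.
elim: k J G => [|k ih] J G kn cG kJ j.
  have mG := cylinder_measurable hF cG.
  have GE : P G = (fine (P G))%:E by rewrite fineK// fin_num_measure.
  have W0 w : partial_sum 0 w = 0%N by rewrite /partial_sum big_pred0.
  rewrite /= pois0; case: eqP => [->|j0].
    rewrite (_ : [set w | _] = setT) ?setTI ?mul1r//.
    by apply/seteqP; split=> w //= _; exact: W0.
  rewrite (_ : [set w | _] = set0) ?set0I ?mul0r ?measure0//.
  by apply/seteqP; split=> w //=; rewrite W0 => /esym.
pose kk : 'I_n := Ordinal kn.
rewrite (_ : [set w | partial_sum k.+1 w = j] =
   [set w | (partial_sum k w + B kk w * Po kk w)%N = j]); last first.
  rewrite (_ : partial_sum k.+1 = fun w => (partial_sum k w + B kk w * Po kk w)%N)//.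
  apply/funext => w; rewrite /partial_sum (bigD1 kk)//= addnC; congr (_ + _)%N.
  by apply: eq_bigl => l; rewrite -val_eqE /=; lia.
apply: (prob_addn (u := bern_pois k)).
apply: (step_event (k := kk)) cG kJ => J' G' cG' kJ'.
exact: ih (ltnW kn) cG' kJ'.
Qed.

Lemma prob_bern_pois_sum (A : set nat) :
  P ((fun w => (\sum_(k < n) B k w * Po k w)%N) @^-1` A) =
  (sumshift p b n (fun j => (j \in A)%:R) 0)%:E.
Proof.
have c0 : cylinder F finset.set0 setT.
  exists (fun=> setT); first by move=> i; rewrite finset.in_set0.
  by apply/seteqP; split=> // w _ i; rewrite /= finset.in_set0.
have E : (fun w => (\sum_(k < n) B k w * Po k w)%N) = partial_sum n.
  by apply/funext => w; apply: eq_bigl => k; rewrite ltn_ord.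
have H j : measurable [set w | partial_sum n w = j] /\
    P [set w | partial_sum n w = j] = (sum_law n j)%:E.
  have := partial_sum_law (leqnn n) c0 _ j; rewrite setIT probability_setT mulr1.
  by apply=> i; rewrite finset.in_set0.
have [lw WA] := prob_discrete (fun j => (H j).1) (fun j => (H j).2).
rewrite E WA mean_sum_law//; exists 1 => m; case: (m \in A) => /=;
  rewrite ?normr1 ?normr0//.
Qed.

End LawRec.

(** * From the recursion on probabilities to invariance *)

Section FixedPoint.
Context {R : realType}.
Variables (c : R) (z : nat -> R).
Hypotheses (c0 : 0 <= c) (lz : is_law z).
Hypothesis zE : forall j, j.+1%:R * (z j - z j.+1) = conv z (pois c) j.

Let abel g N : series (fun j => conv z (pois c) j * avg g j) N =
  series (fun j => z j * g j) N - z N * \sum_(i < N) g i.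
Proof.
elim: N => [|N ih]; first by rewrite /series/= !big_geq// big_ord0 mulr0 subrr.
rewrite !seriesSr ih -zE /avg big_ord_recr/=.
have N1 : N.+1%:R != 0 :> R by rewrite pnatr_eq0.
by field; rewrite ?N1 -?natr1 // in N1 *.
Qed.

(** Summation by parts for the constant sequence [1], where both series
    converge to the total mass. *)
Let NzN : N%:R * z N @[N --> \oo] --> 0.
Proof.
have cl : is_law (conv z (pois c)) by apply: conv_law => //; exact: pois_law.
rewrite (_ : (fun N => _) = fun N => series z N - series (conv z (pois c)) N).
  by rewrite -(subrr 1); apply: cvgB; [exact: lz.2|exact: cl.2].
apply/funext => N; have := abel (fun=> 1) N.
rewrite sumr_const card_ord.
under eq_fun do rewrite /avg sumr_const card_ord divff ?pnatr_eq0// mulr1.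
under [in RHS]eq_fun do rewrite mulr1.
by rewrite mulrC -[in X in _ - X]mulr_natl mulr1 => ->; ring.
Qed.

(** The law of [Z + N_c] at [m] is [(m + 1) (z m - z (m + 1))], and the factor
    [m + 1] cancels the denominator of the average; what remains is a summation by
    parts. *)
Lemma mean_fixed_point g : is_bounded g -> mean z (kstep c g) = mean z g.
Proof.
move=> bg; have ba := avg_bounded bg; have pc := pois_law c0.
have -> : mean z (kstep c g) = mean (conv z (pois c)) (avg g) by rewrite mean_conv.
apply: mean_eq; have [C gC] := bg.
rewrite (_ : series _ = fun N => series (fun j => z j * g j) N - z N * \sum_(i < N) g i);
  last by apply/funext => N; exact: abel.
rewrite -[X in _ --> X]subr0; apply: cvgB; first exact: mean_cvg.
apply/norm_cvg0P.
apply: (@squeeze_cvgr _ _ _ _ (fun=> 0) (fun N => C * (N%:R * z N))).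
- apply: nearW => N; rewrite normr_ge0/= normrM (ger0_norm (lz.1 N)).
  rewrite mulrA (mulrC (C * _)) ler_wpM2l ?(lz.1)//.
  apply: (le_trans (ler_norm_sum _ _ _)).
  apply: (@le_trans _ _ (\sum_(i < N) C)); first by apply: ler_sum.
  by rewrite sumr_const card_ord mulr_natr.
- exact: cvg_cst.
- by rewrite -(mulr0 C); apply: cvgMl_tmp; exact: NzN.
Qed.

End FixedPoint.

(** * Integration against a density *)

(** The density agrees almost everywhere with the Radon-Nikodym derivative. *)
Lemma integral_density {R : realType} d (T : measurableType d)
    (nu : {finite_measure set T -> \bar R})
    (m : {sigma_finite_measure set T -> \bar R}) (f g : T -> \bar R) :
  measurable_fun [set: T] f -> (forall x, 0 <= f x)%E ->
  (forall A, measurable A -> nu A = \int[m]_(x in A) f x)%E ->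
  measurable_fun [set: T] g -> (forall x, 0 <= g x)%E ->
  (\int[nu]_x g x = \int[m]_x (g x * f x))%E.
Proof.
move=> mf f0 nuE mg g0.
have dom : nu `<< m.
  apply/null_content_dominatesP => A mA mA0; rewrite nuE//.
  apply: null_set_integral => //. exact: measurable_funTS.
rewrite -(Radon_Nikodym_SigmaFinite.change_of_variables dom g0 measurableT mg).
have mrn := Radon_Nikodym_SigmaFinite.f_integrable dom.
apply: ge0_ae_eq_integral => //.
- by apply: emeasurable_funM => //; exact: measurable_int mrn.
- by apply: emeasurable_funM.
- by move=> x _; rewrite mule_ge0// Radon_Nikodym_SigmaFinite.f_ge0.
- by move=> x _; rewrite mule_ge0.
apply: ae_eqe_mul2l; apply: integral_ae_eq => // E _ mE.
by rewrite -nuE// (Radon_Nikodym_SigmaFinite.f_integral dom).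
Qed.

(** * Integrals of continuous functions over segments *)

Section ContinuousIntegral.
Context {R : realType}.
Notation leb := (@lebesgue_measure R).
Implicit Types (f g : R -> R) (a b : R).

Definition cint a b f : R := (\int[leb]_(x in `[a, b]) f x)%R.

Lemma cint_integrable a b f : continuous f -> leb.-integrable `[a, b] (EFin \o f).
Proof.
move=> cf; apply: continuous_compact_integrable; first exact: segment_compact.
exact: continuous_subspaceT.
Qed.

Lemma cintB a b f g : continuous f -> continuous g ->
  cint a b (fun x => f x - g x) = cint a b f - cint a b g.
Proof. by move=> cf cg; apply: RintegralB => //; exact: cint_integrable. Qed.

Lemma cintZ a b k f : continuous f -> cint a b (fun x => k * f x) = k * cint a b f.
Proof. by move=> cf; apply: RintegralZl => //; exact: cint_integrable. Qed.

Lemma continuous_sum_ord n (f : nat -> R -> R) : (forall i, continuous (f i)) ->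
  continuous (fun x => \sum_(i < n) f i x).
Proof.
move=> cf; elim: n => [|n ih].
  rewrite (_ : (fun _ => _) = cst 0); first by move=> x; exact: cvg_cst.
  by apply/funext => x; rewrite big_ord0.
rewrite (_ : (fun _ => _) = (fun x => \sum_(i < n) f i x + f n x)).
  by move=> x; apply: cvgD; [exact: ih|exact: cf].
by apply/funext => x; rewrite big_ord_recr.
Qed.

Lemma cint_sum a b n (f : nat -> R -> R) : (forall i, continuous (f i)) ->
  cint a b (fun x => \sum_(i < n) f i x) = \sum_(i < n) cint a b (f i).
Proof.
move=> cf; elim: n => [|n ih].
  rewrite big_ord0 /cint /Rintegral -[RHS]/(fine 0%E); congr fine.
  by under eq_integral do rewrite big_ord0; rewrite integral0.
rewrite big_ord_recr/= -ih /cint.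
under eq_Rintegral do rewrite big_ord_recr/=.
apply: RintegralD => //; apply: cint_integrable => //.
exact: continuous_sum_ord.
Qed.

Lemma cint_chasles a b e f : continuous f -> a <= b -> b <= e ->
  cint a e f = cint a b f + cint b e f.
Proof.
move=> cf ab be; have := @Rintegral_itvB _ f (BLeft a) (BRight e) b
  (cint_integrable a e cf).
rewrite !bnd_simp => /(_ ab be); rewrite /cint.
rewrite [X in _ = X -> _]Rintegral_itv_obnd_cbnd => [<-|];
  first by rewrite addrC subrK.
by apply: integrableS (cint_integrable b e cf) => //; apply: subset_itvr;
  rewrite bnd_simp.
Qed.

Lemma cint_ftc a b f F : a < b -> continuous f -> continuous F ->
  (forall x, a < x < b -> is_derive x 1 F (f x)) -> cint a b f = F b - F a.
Proof.
move=> ab cf cF dF; rewrite /cint /Rintegral (@continuous_FTC2 _ f F)//.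
- exact: continuous_subspaceT.
- split.
  + by move=> x; rewrite in_itv/= => /dF[].
  + exact/cvg_at_right_filter/cF.
  + exact/cvg_at_left_filter/cF.
- by move=> x; rewrite in_itv/= => /dF[_ <-]; rewrite derive1E.
Qed.

Lemma cint_shift a b k f : a <= b -> continuous f ->
  cint (a - k) (b - k) f = cint a b (fun x => f (x - k)).
Proof.
move=> ab cf; rewrite /cint /Rintegral; congr fine.
have dS x : is_derive x (1:R) (fun y : R => y - k) 1.
  by apply: is_derive_eq; rewrite subr0.
have S1 : ((fun y : R => y - k)^`())%classic = cst 1.
  by apply/funext => x; rewrite derive1E derive_val.
rewrite (@integration_by_substitution_increasing _ (fun y => y - k) f a b) ?S1//.
- by apply: eq_integral => x _; rewrite mulrfctE /= mulr1.
- by move=> x y _ _ xy; rewrite ltrD2r.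
- by move=> x _; exact: cvg_cst.
- exact: is_cvg_cst.
- exact: is_cvg_cst.
- have cS : continuous (fun y : R => y - k).
    by move=> x; apply: cvgB; [exact: cvg_id|exact: cvg_cst].
  by split=> [x _| |]; [|exact/cvg_at_right_filter/cS|exact/cvg_at_left_filter/cS].
- exact: continuous_subspaceT.
Qed.

End ContinuousIntegral.

(** * The Dickman function *)

Section Dickman.
Context {R : realType}.
Variables (rho : R -> R).
Hypothesis drho : dickman_function rho.

(** The continuous extension of [rho] by [1] to the left of [0]; it is
    continuous on the whole line, which spares the treatment of end points. *)
Definition rho_ext (x : R) : R := rho (Num.max 0 x).
Local Notation r := rho_ext.

Lemma rho_extE x : 0 <= x -> r x = rho x.
Proof. by move=> x0; rewrite /rho_ext max_r. Qed.

Lemma rho_ext1 x : x <= 1 -> r x = 1.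
Proof.
move=> x1; case: drho => _ h _; apply: h.
by rewrite le_max lexx/= ge_max ler01.
Qed.

Lemma near_rho_ext (x : R) : 0 < x -> \forall y \near x, rho y = r y.
Proof.
move=> x0; near=> y; rewrite rho_extE// ltW//; near: y; exact: lt_nbhsr.
Unshelve. all: by end_near. Qed.

Lemma rho_ext_continuous : continuous r.
Proof.
move=> x; have [x1|x1] := ltP x 1.
  have nx : \forall y \near x, cst 1 y = r y.
    near=> y; rewrite rho_ext1//= ltW//; near: y; exact: lt_nbhsl.
  rewrite /continuous_at rho_ext1 ?ltW//.
  apply: cvg_trans (near_eq_cvg nx) _; exact: cvg_cst.
have x0 : 0 < x := lt_le_trans ltr01 x1.
case: drho => crho _ _; rewrite /continuous_at rho_extE ?ltW//.
apply: cvg_trans (near_eq_cvg (near_rho_ext x0)) _.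
have : {within `[0, x + 1], continuous rho}.
  by apply: continuous_subspaceW crho; apply: subset_itvl; rewrite bnd_simp.
have x2 : 0 < x + 1 by lra.
move=> /(within_continuous_continuous x2); apply.
by rewrite in_itv/=; apply/andP; split => //; lra.
Unshelve. all: by end_near. Qed.

Lemma rho_ext_derive (x : R) : 1 < x -> is_derive x 1 r (- r (x - 1) / x).
Proof.
move=> x1; have x0 : 0 < x by lra.
apply: (near_eq_is_derive (near_rho_ext x0)).
case: drho => _ _ /(_ x x1)[dr]; rewrite derive1E -[rho (x - 1)]rho_extE; last by lra.
move=> e; split=> //; apply: (mulfI (lt0r_neq0 x0)).
by rewrite e mulrCA divff ?gt_eqF// mulr1.
Qed.

End Dickman.

(** * Poisson probabilities as functions of the parameter *)

Section PoissonDerivative.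
Context {R : realType}.

Lemma pois_derive j (y : R) :
  is_derive y 1 (fun y : R => pois y j.+1) (pois y j - pois y j.+1).
Proof.
have h1 : is_derive y 1 (expR \o -%R) (- expR (- y)).
  by apply: is_derive_eq; rewrite mulrN1.
have h2 : is_derive y 1 (fun y : R => y ^+ j.+1) (j.+1%:R * y ^+ j).
  rewrite (_ : (fun y => _) = id ^+ j.+1); last by apply/funext => x;
    rewrite exprfctE.
  by apply: is_derive_eq; rewrite /GRing.scale/= mulr1.
rewrite (_ : (fun y => _) =
  (expR \o -%R) * ((j.+1`!%:R^-1 : R) *: (fun y : R => y ^+ j.+1))); last first.
  by apply/funext => x; rewrite /pois mulrfctE /=; congr (_ * _); exact: mulrC.
apply: is_derive_eq; rewrite /= /pois /GRing.scale/= /GRing.scale/= factS natrM.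
have F : j`!%:R != 0 :> R by rewrite pnatr_eq0 -lt0n fact_gt0.
have G : j.+1%:R != 0 :> R by rewrite pnatr_eq0.
move: (j.+1%:R) G => k G; field; by rewrite F G.
Qed.

Lemma pois_continuous j : continuous (fun y : R => pois y j).
Proof.
move=> y; apply: cvgM.
  apply: (@continuous_comp _ _ _ (fun y : R => - y) expR); first exact: cvgN.
  exact: continuous_expR.
by apply: cvgMr_tmp; exact: exprn_continuous.
Qed.

Variable c : R.
Hypothesis c0 : 0 < c.

Definition spois (j : nat) (x : R) : R := pois (c * x) j.

Lemma spois_continuous j : continuous (spois j).
Proof.
move=> x; apply: (@continuous_comp _ _ _ (fun x : R => c * x) (fun y => pois y j)).
  by apply: cvgMl_tmp; exact: cvg_id.
exact: pois_continuous.
Qed.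

Lemma spoisS j x : x * spois j x = (j.+1%:R / c) * spois j.+1 x.
Proof.
by rewrite mulrAC /spois poisS; have c1 := lt0r_neq0 c0; field.
Qed.

(** By [spoisS] the function is a multiple of the next Poisson probability. *)
Lemma spois_derive j (x : R) :
  is_derive x 1 (fun x => x * spois j x) (j.+1%:R * (spois j x - spois j.+1 x)).
Proof.
rewrite (_ : (fun x => _) = (j.+1%:R / c) *: ((fun y => pois y j.+1) \o *%R c)).
  have h : is_derive x 1 ( *%R c) c.
    by apply: is_derive_eq; rewrite /GRing.scale/= mulr1.
  have h2 := is_derive1_comp (pois_derive j (c * x)) h.
  apply: is_derive_eq; rewrite /GRing.scale/= /spois.
  by have c1 := lt0r_neq0 c0; field.
by apply/funext => y; rewrite spoisS.
Qed.

Lemma spois_ge0 j x : 0 <= x -> 0 <= spois j x.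
Proof. by move=> x0; apply: pois_ge0; rewrite mulr_ge0// ltW. Qed.

Lemma spoisD j x : spois j (x + 1) = \sum_(i < j.+1) spois i x * pois c (j - i)%N.
Proof. by rewrite /spois mulrDr mulr1 -pois_conv. Qed.

End PoissonDerivative.

(** * The recursion satisfied by a Dickman mixture of Poisson laws *)

Section DickmanIdentity.
Context {R : realType}.
Variables (rho : R -> R).
Hypothesis drho : dickman_function rho.
Local Notation r := (rho_ext rho).
Hypothesis r0 : forall x, 0 <= r x.

(** The extension is [1] up to [1], and decreasing afterwards by the delay
    equation. *)
Lemma rho_ext_le1 x : r x <= 1.
Proof.
have [x1|x1] := leP x 1; first by rewrite rho_ext1.
have rd y : y \in `]1, x[ -> is_derive y 1 r (- r (y - 1) / y).
  by rewrite in_itv/= => /andP[y1 _]; exact: rho_ext_derive.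
rewrite -(rho_ext1 drho (lexx 1)).
apply: (@ler0_derive1_le_cc _ r 1 x) => //.
- by move=> y /rd[].
- move=> y yI; have [_ e] := rd _ yI; rewrite derive1E e mulNr oppr_le0.
  by rewrite divr_ge0//; move: yI; rewrite in_itv/=; lra.
- by apply: continuous_subspaceT; exact: rho_ext_continuous.
- by rewrite in_itv/= lexx ltW.
- by rewrite in_itv/= lexx ltW.
- exact: ltW.
Qed.

Variable c : R.
Hypothesis c0 : 0 < c.

(** The probability of [j] under the mixture, up to the normalising
    constant and with the mixing density cut at [M]. *)
Definition dickman_int (j : nat) (M : R) : R := cint 0 M (fun x => r x * spois c j x).

Let rspois_continuous j : continuous (fun x : R => r x * spois c j x).
Proof.
by move=> x; apply: cvgM; [exact: rho_ext_continuous|exact: spois_continuous].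
Qed.

Let sub1_continuous (k : R) : continuous (fun x : R => x - k).
Proof. by move=> x; apply: cvgB; [exact: cvg_id|exact: cvg_cst]. Qed.

(** The derivative of [r x * (x * spois c j x)] is
    [j.+1 * r x * (spois c j x - spois c j.+1 x)], minus
    [r (x - 1) * spois c j x] when [1 < x].  The left-hand side integrates
    the first expression over [[0, M]]; after the change of variable [x - 1]
    and [spoisD], the delayed term becomes the convolution with the Poisson
    law of mean [c]. *)
Lemma dickman_int_parts j M : 1 < M ->
  j.+1%:R * (dickman_int j M - dickman_int j.+1 M) =
  r M * (M * spois c j M) + conv (fun i => dickman_int i (M - 1)) (pois c) j.
Proof.
move=> M1; pose psi x := j.+1%:R * (spois c j x - spois c j.+1 x).
have cpsi : continuous psi.
  by move=> x; apply: cvgMl_tmp; apply: cvgB; exact: spois_continuous.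
have crpsi : continuous (fun x : R => r x * psi x).
  by move=> x; apply: cvgM; [exact: rho_ext_continuous|exact: cpsi].
have cxphi : continuous (fun x : R => x * spois c j x).
  by move=> x; apply: cvgM; [exact: cvg_id|exact: spois_continuous].
have crs : continuous (fun x : R => r (x - 1)).
  move=> x; apply: (@continuous_comp _ _ _ (fun x : R => x - 1) r).
    exact: sub1_continuous.
  exact: rho_ext_continuous.
have crsphi : continuous (fun x : R => r (x - 1) * spois c j x).
  by move=> x; apply: cvgM; [exact: crs|exact: spois_continuous].
have -> : j.+1%:R * (dickman_int j M - dickman_int j.+1 M) =
  cint 0 M (fun x => r x * psi x).
  rewrite -cintB// -cintZ; last by move=> x; apply: cvgB; exact: rspois_continuous.
  by congr cint; apply/funext => x; rewrite /psi; ring.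
rewrite (@cint_chasles _ 0 1 M)//; last exact: ltW.
have -> : cint 0 1 (fun x => r x * psi x) = spois c j 1.
  rewrite (_ : cint _ _ _ = cint 0 1 psi); last first.
    apply: eq_Rintegral => x; rewrite inE/= in_itv/= => /andP[_ x1].
    by rewrite rho_ext1// mul1r.
  have := @cint_ftc _ 0 1 psi (fun x => x * spois c j x) ltr01 cpsi cxphi
    (fun x _ => spois_derive c0 j x).
  by rewrite mul1r mul0r subr0.
have : cint 1 M (fun x => r x * psi x - r (x - 1) * spois c j x) =
    r M * (M * spois c j M) - spois c j 1.
  have -> : spois c j 1 = r 1 * (1 * spois c j 1) by rewrite rho_ext1// !mul1r.
  apply: (@cint_ftc _ 1 M _ (fun x => r x * (x * spois c j x))) => //.
  - by move=> x; apply: cvgB; [exact: crpsi|exact: crsphi].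
  - by move=> x; apply: cvgM; [exact: rho_ext_continuous|exact: cxphi].
  - move=> x /andP[x1 _]; have dr := rho_ext_derive drho x1.
    have dp := spois_derive c0 j x.
    apply: (is_derive_eq (is_deriveM dr dp)).
    have x0 : x != 0 by rewrite gt_eqF//; lra.
    by rewrite /GRing.scale/= /psi; field.
rewrite cintB// => /eqP; rewrite subr_eq => /eqP ->.
have -> : cint 1 M (fun x => r (x - 1) * spois c j x) =
    conv (fun i => dickman_int i (M - 1)) (pois c) j; last by ring.
pose g y := r y * spois c j (y + 1).
have cg : continuous g.
  move=> x; apply: cvgM; first exact: rho_ext_continuous.
  apply: (@continuous_comp _ _ _ (fun x : R => x + 1) (spois c j)).
    by apply: cvgD; [exact: cvg_id|exact: cvg_cst].
  exact: spois_continuous.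
rewrite (_ : (fun x => _) = (fun x => g (x - 1))); last first.
  by apply/funext => x; rewrite /g subrK.
rewrite -cint_shift//; last exact: ltW.
rewrite subrr /conv (_ : g = fun x => \sum_(i < j.+1) pois c (j - i)%N * (r x * spois c i x)).
  rewrite (@cint_sum _ _ _ j.+1 (fun i x => pois c (j - i)%N * (r x * spois c i x))).
    by apply: eq_bigr => i _; rewrite cintZ// mulrC.
  by move=> i x; apply: cvgMl_tmp; exact: rspois_continuous.
apply/funext => x; rewrite /g spoisD mulr_sumr; apply: eq_bigr => i _; ring.
Qed.

(** Since [j.+1 * pois y j.+1 = y * pois y j] and probabilities are at most [1]. *)
Lemma spois_le j x : 0 < x -> spois c j x <= j.+1%:R / (c * x).
Proof.
move=> x0; have cx : 0 < c * x by rewrite mulr_gt0.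
rewrite /spois ler_pdivlMr// mulrC -poisS ler_piMr//.
have [p0 p1] := pois_law (ltW cx).
rewrite -(cvg_lim _ p1)//.
have nd := @nondecreasing_series _ _ xpredT 0%N (fun i _ _ => p0 i).
apply: (@le_trans _ _ (series (pois (c * x)) j.+2)).
  by rewrite seriesSr lerDr sumr_ge0.
by apply: nondecreasing_cvgn_le => //; exact: cvgP p1.
Qed.

Lemma dickman_boundary_cvg0 j : r N.+1%:R * (N.+1%:R * spois c j N.+1%:R) @[N --> \oo] --> 0.
Proof.
apply: (@squeeze_cvgr _ _ _ _ (fun=> 0)
  (fun N : nat => (j.+1%:R * j.+2%:R / c ^+ 2) * harmonic N)).
- apply: nearW => N; apply/andP; split.
    by apply: mulr_ge0 => //; apply: mulr_ge0 => //; exact: spois_ge0.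
  have xphi0 : 0 <= N.+1%:R * spois c j N.+1%:R by apply: mulr_ge0 => //;
    exact: spois_ge0.
  apply: (le_trans (ler_piMl xphi0 (rho_ext_le1 _))).
  rewrite spoisS//.
  have -> : j.+1%:R * j.+2%:R / c ^+ 2 * harmonic N =
      j.+1%:R / c * (j.+2%:R / (c * N.+1%:R)) :> R.
    rewrite /harmonic/=; have N1 : N.+1%:R != 0 :> R by rewrite pnatr_eq0.
    have c1 := lt0r_neq0 c0; move: (N.+1%:R) N1 => a a0.
    by field; rewrite a0 c1.
  apply: ler_wpM2l; first by rewrite divr_ge0// ltW.
  by apply: spois_le; rewrite ltr0n.
- exact: cvg_cst.
- by rewrite -(mulr0 (j.+1%:R * j.+2%:R / c ^+ 2)); apply: cvgMl_tmp;
  exact: cvg_harmonic.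
Qed.

(** The limit of [dickman_int_parts] as [M] tends to infinity along the
    integers, where the boundary term disappears. *)
Lemma dickman_recursion (k : R) (z : nat -> R) :
  (forall j, k * dickman_int j N%:R @[N --> \oo] --> z j) ->
  forall j, j.+1%:R * (z j - z j.+1) = conv z (pois c) j.
Proof.
move=> kz j.
have kz1 i : k * dickman_int i N.+1%:R @[N --> \oo] --> z i.
  by have := kz i; rewrite -cvg_shiftS.
have kz2 i : k * dickman_int i N.+2%:R @[N --> \oo] --> z i.
  by have := kz1 i; rewrite -(cvg_shiftS (fun N => k * dickman_int i N.+1%:R)).
have L : j.+1%:R * (k * dickman_int j N.+2%:R - k * dickman_int j.+1 N.+2%:R) @[N --> \oo]
    --> j.+1%:R * (z j - z j.+1).
  by apply: cvgMl_tmp; apply: cvgB; exact: kz2.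
have B : k * (r N.+2%:R * (N.+2%:R * spois c j N.+2%:R)) @[N --> \oo] --> 0.
  rewrite -(mulr0 k); apply: cvgMl_tmp.
  by have := dickman_boundary_cvg0 j;
    rewrite -(cvg_shiftS (fun N => r N.+1%:R * (N.+1%:R * _ N.+1%:R))).
have S m : (\sum_(i < m) (k * dickman_int i N.+1%:R) * pois c (j - i)%N) @[N --> \oo] -->
    \sum_(i < m) z i * pois c (j - i)%N.
  elim: m => [|m ih].
    by rewrite big_ord0; under eq_fun do rewrite big_ord0; exact: cvg_cst.
  rewrite big_ord_recr/=; under eq_fun do rewrite big_ord_recr/=.
  by apply: cvgD => //; apply: cvgMr_tmp; exact: kz1.
apply: (cvg_unique _ L) => //; rewrite -[conv _ _ _]add0r.
rewrite (_ : (fun N => _) = (fun N :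
  nat => k * (r N.+2%:R * (N.+2%:R * spois c j N.+2%:R))
  + \sum_(i < j.+1) (k * dickman_int i N.+1%:R) * pois c (j - i)%N)).
  by apply: cvgD => //; exact: S.
apply/funext => N.
have N2 : 1 < N.+2%:R :> R by rewrite ltr1n.
have := dickman_int_parts j N2.
have -> : N.+2%:R - 1 = N.+1%:R :> R by rewrite -natr1 addrK.
move=> E; transitivity (k * (j.+1%:R * (dickman_int j N.+2%:R - dickman_int j.+1 N.+2%:R))).
  by ring.
rewrite E mulrDr; congr (_ + _).
by rewrite /conv mulr_sumr; apply: eq_bigr => i _; rewrite mulrA.
Qed.

End DickmanIdentity.

(** * Expectations under the Dickman law *)

Section DickmanLaw.
Context {R : realType} d (T : measurableType d) (P : probability T R).
Variables (D : {RV P >-> R}) (rho : R -> R) (k : R).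
Hypothesis drho : dickman_function rho.
Hypothesis k0 : 0 < k.
Hypothesis hD : forall A : set R, measurable A ->
  distribution P D A =
  (\int[lebesgue_measure]_(x in A `&` `]0%R, +oo[) (k * rho x)%:E)%E.
Local Notation r := (rho_ext rho).
Notation leb := (@lebesgue_measure R).

Let hDr A : measurable A -> distribution P D A =
  (\int[leb]_(x in A `&` `]0%R, +oo[) (k * r x)%:E)%E.
Proof.
move=> mA; rewrite hD//; apply: eq_integral => x.
by rewrite inE/= in_itv/= andbT => -[_ x0]; rewrite rho_extE// ltW.
Qed.

Let mr : measurable_fun [set: R] r.
Proof. by apply: continuous_measurable_fun; exact: rho_ext_continuous. Qed.

(** Where [rho] is negative it is so on an interval by continuity, and that
    interval would have a negative probability.  Nonnegativity is thus read off the
    law rather than derived from the delay equation. *)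
Lemma dickman_ge0 (x : R) : 0 <= r x.
Proof.
rewrite leNgt; apply/negP => rx0.
have x1 : 1 < x by rewrite ltNge; apply/negP => x1; move: rx0; rewrite rho_ext1//
  ltr10.
have rx2 : r x < r x / 2 by lra.
have := @cvgr_lt R R (nbhs x) _ r (r x) (@rho_ext_continuous R rho drho x) _ rx2.
have : \forall y \near x, 0 < y by apply: lt_nbhsr; lra.
move=> nx ny; have := filterI nx (ny _).
rewrite nbhs_ballP => -[e /= e0 he] {nx ny}.
pose A : set R := `]x - e, x + e[%classic.
have Ay y : A y -> 0 < y /\ r y < r x / 2.
  by rewrite /A /= in_itv/= => yA; apply: he; rewrite /ball/= distrC ltr_distl.
have mA : measurable A by exact: measurable_itv.
have : (0 <= distribution P D A)%E by exact: measure_ge0.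
apply/negP; rewrite -ltNge hDr//.
rewrite (_ : A `&` _ = A); last first.
  by apply/setIidPl => y /Ay[y0 _]; rewrite /= in_itv/= y0.
rewrite (_ : (\int[leb]_(y in A) _ = - (\int[leb]_(y in A) (- (k * r y))%:E))%E).
  rewrite oppe_lt0.
  apply: (@lt_le_trans _ _ (\int[leb]_(y in A) (cst (- (k * (r x / 2)))%:E) y)%E).
    rewrite integral_cst//= /A lebesgue_measure_itv/= lte_fin.
    have -> : x - e < x + e by lra.
    rewrite -EFinD -EFinM lte_fin; apply: mulr_gt0; last by lra.
    by rewrite oppr_gt0 pmulr_rlt0//; lra.
  apply: ge0_le_integral => //.
  - by move=> y _ /=; rewrite lee_fin oppr_ge0 pmulr_rle0//; lra.
  - apply/measurable_EFinP/measurable_funN/measurable_funM => //.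
    exact: measurable_funTS.
  - by move=> y /Ay[_ ry] /=; rewrite lee_fin lerN2 ler_pM2l// ltW.
rewrite -integral_ge0N; first by apply: eq_integral => y _; rewrite -EFinN opprK.
by move=> y /Ay[_ ry]; rewrite lee_fin oppr_ge0 pmulr_rle0//; lra.
Qed.

Lemma dickman_negligible : P [set w | D w <= 0] = 0.
Proof.
rewrite (_ : P _ = distribution P D `]-oo, 0%R]); last first.
  by congr (P _); apply/seteqP; split=> w /=; rewrite in_itv.
rewrite hDr// (_ : _ `&` _ = set0) ?integral_set0//.
by apply/seteqP; split=> // x /=; rewrite !in_itv/= andbT => -[]; lra.
Qed.

Variable g : R -> R.
Hypothesis cg : continuous g.
Hypothesis g0 : forall x, 0 <= x -> 0 <= g x.

Lemma dickman_expectation :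
  (\int[P]_w (g (D w))%:E = \int[leb]_(x in `]0%R, +oo[) (k * (r x * g x))%:E)%E.
Proof.
pose E : set R := `]0%R, +oo[%classic.
have mE : measurable E by exact: measurable_itv.
pose gp : R -> \bar R := (fun x => (g x)%:E) \_ E.
have mg : measurable_fun [set: R] (fun x => (g x)%:E).
  by apply/measurable_EFinP; exact: continuous_measurable_fun.
have mgp : measurable_fun [set: R] gp.
  by apply/(measurable_restrictT _ mE); exact: measurable_funTS.
have gp0 x : (0 <= gp x)%E.
  rewrite /gp patchE; case: ifPn => // /set_mem.
  by rewrite /E/= in_itv/= andbT => x0; rewrite lee_fin g0// ltW.
pose f : R -> \bar R := (fun x => (k * r x)%:E) \_ E.
have mf : measurable_fun [set: R] f.
  apply/(measurable_restrictT _ mE)/measurable_funTS/measurable_EFinP.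
  exact: measurable_funM.
have f0 x : (0 <= f x)%E.
  rewrite /f patchE; case: ifPn => // _.
  by rewrite lee_fin mulr_ge0 ?dickman_ge0// ltW.
(* [g] may be negative on the negative half-line, which [D] avoids almost surely *)
transitivity (\int[P]_w gp (D w))%E.
  apply: ae_eq_integral => //.
  - exact: (measurableT_comp mg).
  - exact: (measurableT_comp mgp).
  - exists [set w | D w <= 0]; split; last 1 first.
    + move=> w /= /not_implyP[_]; apply: contra_notP => /negP; rewrite -ltNge => Dw.
      by rewrite /gp patchE mem_set// /E/= in_itv/= Dw.
    + rewrite (_ : [set w | _] = D @^-1` `]-oo, 0%R]).
        exact: measurable_funPTI.
      by apply/seteqP; split=> w /=; rewrite in_itv.
    + exact: dickman_negligible.
have mD : measurable_fun [set: T] (D : T -> measurableTypeR R).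
  exact: (measurable_funPT D).
(* the Lebesgue measure lives on [measurableTypeR R], whose measurable sets are
   those of [R] but which is a different structure *)
pose D' : {mfun T >-> measurableTypeR R} :=
  @mfun_Sub _ _ T (measurableTypeR R) D (mem_set mD).
have dE (A : set R) : measurable A -> distribution P D' A =
  (\int[leb]_(x in A) f x)%E.
  by move=> mA; rewrite -[LHS]/(distribution P D A) hDr// integral_mkcondr.
transitivity (\int[distribution P D']_x gp x)%E.
  by rewrite (ge0_integral_distribution D' mgp gp0).
rewrite (@integral_density R _ (measurableTypeR R) (distribution P D') leb f gp
  mf f0 dE mgp gp0).
rewrite [RHS]integral_mkcond; apply: eq_integral => x _.
rewrite /gp /f !patchE; case: ifPn => _; last by rewrite mule0.
by rewrite -EFinM; congr EFin; ring.
Qed.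

Lemma dickman_expectation_cvg (l : R) :
  (\int[P]_w (g (D w))%:E = l%:E)%E ->
  k * cint 0 N%:R (fun x => r x * g x) @[N --> \oo] --> l.
Proof.
rewrite dickman_expectation => lE.
have crg : continuous (fun x : R => k * (r x * g x)).
  move=> x; apply: cvgMl_tmp; apply: cvgM; [exact: rho_ext_continuous|exact: cg].
have m0 (A : set R) : measurable_fun A (fun x => (k * (r x * g x))%:E).
  by apply/measurable_funTS/measurable_EFinP; exact: continuous_measurable_fun.
pose F (N : nat) : set R := `]0%R, N%:R]%classic.
have UF : \bigcup_N F N = `]0%R, +oo[%classic.
  by rewrite itv_bndy_bigcup_BRight; apply: eq_bigcupr => N _; rewrite add0r.
have ndF : nondecreasing_seq F.
  move=> a b ab; apply/subsetPset; apply: subset_itvl; rewrite bnd_simp.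
  by rewrite ler_nat.
have F0 N x : F N x -> (0 <= (k * (r x * g x))%:E)%E.
  rewrite /F /= in_itv/= => /andP[x0 _]; rewrite lee_fin.
  apply: mulr_ge0; first exact: ltW.
  by apply: mulr_ge0; [exact: dickman_ge0|apply/g0/ltW].
have := @ge0_nondecreasing_set_cvg_integral _ (measurableTypeR R) R F
  (fun x => (k * (r x * g x))%:E) leb ndF (fun N => measurable_itv _)
  (fun N => m0 (F N)) F0.
rewrite UF lE => H.
suff /fine_cvgP[] : (k * cint 0 N%:R (fun x => r x * g x))%:E @[N --> \oo] --> l%:E.
  by [].
rewrite (_ : (fun N => _) =
  (fun N : nat => \int[leb]_(x in F N) (k * (r x * g x))%:E)%E)//.
apply/funext => N; rewrite integral_itv_obnd_cbnd//.
rewrite -cintZ; last first.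
  by move=> x; apply: cvgM; [exact: rho_ext_continuous|exact: cg].
rewrite /cint /Rintegral fineK//; apply: integrable_fin_num => //.
exact: (cint_integrable 0 N%:R crg).
Qed.

End DickmanLaw.

(** * The mixed Poisson law and the total variation bound *)

(** From [expR c = expR (c / 2) ^ 2 >= (1 + c / 2) ^ 2 >= 2 c] one gets
    [beta <= 1 / 2], so [1 / (4 * beta ^ 2)] is already at least [1]. *)
Lemma min_factor_eq1 {R : realType} (c : R) : 0 < c ->
  let beta := c * expR (- c) in
  Num.min 1 (beta^-1 * ((4 * beta)^-1 + log_plus (2 * beta))) = 1.
Proof.
move=> c0 beta; have b0 : 0 < beta by rewrite mulr_gt0 ?expR_gt0.
have b2 : beta <= 2^-1.
  rewrite /beta expRN ler_pdivrMr ?expR_gt0//.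
  have e2 : 1 + c / 2 <= expR (c / 2) by exact: expR_ge1Dx.
  have -> : expR c = expR (c / 2) ^+ 2 by rewrite expr2 -expRD -splitr.
  move: (expR _) e2 => e e2.
  have e4 : 0 <= (e - (1 + c / 2)) * (e + (1 + c / 2)) by apply: mulr_ge0; lra.
  by have := sqr_ge0 (c / 2 - 1); rewrite !expr2 in e4 *; lra.
clearbody beta; apply: min_l; rewrite -[leLHS](mulVf (lt0r_neq0 b0)).
apply: ler_wpM2l; first by rewrite invr_ge0 ltW.
apply: (@le_trans _ _ (4 * beta)^-1).
  rewrite -[leRHS]div1r ler_pdivlMr ?mulr_gt0//.
  by have := b0; have := b2; nra.
by rewrite lerDl /log_plus le_max lexx.
Qed.

Lemma mixed_poisson_dickman_law {R : realType} d2 d3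
    (T2 : measurableType d2) (T3 : measurableType d3)
    (P2 : probability T2 R) (P3 : probability T3 R) (c : R) (hc : 0 < c)
    (D : {RV P3 >-> R}) (hD : standard_dickman P3 D)
    (Z : {RV P2 >-> nat}) (hZ : mixed_poisson P2 P3 (fun w => c * D w) Z) :
  exists z : nat -> R, [/\ is_law z,
    forall g, is_bounded g -> mean z (kstep c g) = mean z g &
    forall A, P2 (Z @^-1` A) = (mean z (fun j => (j \in A)%:R))%:E].
Proof.
have [rho drho {}hD] := hD.
set k := expR _ in hD; have k0 : 0 < k by exact: expR_gt0.
pose z j := fine (P2 [set w | Z w = j]).
have mZ j : measurable [set w | Z w = j].
  exact: (measurable_funPTI Z (Y := [set j])).
have zE j : P2 [set w | Z w = j] = (z j)%:E.
  by rewrite fineK// fin_num_measure.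
have [lz zA] := prob_discrete mZ zE.
exists z; split => //; apply: mean_fixed_point => //; first exact: ltW.
have r0 x := dickman_ge0 drho k0 hD x.
apply: (dickman_recursion drho r0 hc (k := k)) => j.
have F : j`!%:R != 0 :> R by rewrite pnatr_eq0 -lt0n fact_gt0.
pose g x := expR (- (c * x)) * (c * x) ^+ j.
have gphi : spois c j = fun x => g x * j`!%:R^-1.
  by apply/funext => x; rewrite /spois /pois mulrA.
have cg : continuous g.
  have -> : g = fun x => spois c j x * j`!%:R by rewrite gphi; apply/funext => x;
    rewrite mulfVK.
  by move=> x; apply: cvgMr_tmp; exact: spois_continuous.
have g0 x : 0 <= x -> 0 <= g x.
  by move=> x0; rewrite mulr_ge0 ?expR_ge0// exprn_ge0// mulr_ge0// ltW.
have E : (\int[P3]_w (g (D w))%:E = (z j * j`!%:R)%:E)%E.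
  rewrite EFinM -zE hZ -muleA -EFinM mulVf// mule1.
  by rewrite unlock.
have := dickman_expectation_cvg drho k0 hD cg g0 E.
move=> /(cvgMr_tmp (b := j`!%:R^-1)); rewrite mulfK//.
rewrite (_ : (fun N => _) = (fun N => k * dickman_int rho c j N%:R))//.
apply/funext => N; rewrite /dickman_int gphi -mulrA; congr (_ * _).
rewrite mulrC -cintZ; last first.
  by move=> x; apply: cvgM; [exact: rho_ext_continuous|exact: cg].
by congr cint; apply/funext => x; ring.
Qed.

Theorem proposition4 (R : realType)
    (d1 d2 d3 : measure_display)
    (T1 : measurableType d1) (T2 : measurableType d2) (T3 : measurableType d3)
    (P1 : probability T1 R) (P2 : probability T2 R) (P3 : probability T3 R)
    (n : nat) (c : R) (hn : (1 <= n)%N) (hc : 0 < c)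
    (B : 'I_n -> {RV P1 >-> bool}) (Po : 'I_n -> {RV P1 >-> nat})
    (hB : forall k : 'I_n,
       distribution P1 (B k) = bernoulli_prob (k.+1%:R^-1)
         :> (set bool -> \bar R))
    (hPo : forall k : 'I_n, poisson_distributed P1 (c * k.+1%:R / n%:R) (Po k))
    (hind : independent_systems P1 (fun i : 'I_n + 'I_n =>
       match i with inl k => sigma_of (B k) | inr k => sigma_of (Po k) end))
    (D : {RV P3 >-> R}) (hD : standard_dickman P3 D)
    (Z : {RV P2 >-> nat}) (hZ : mixed_poisson P2 P3 (fun w => c * D w) Z) :
  let W := fun w : T1 => (\sum_(k < n) B k w * Po k w)%N in
  let beta := c * expR (- c) in
  is_true (dTV P1 P2 W Z <=
   (5 * c ^+ 2 / (2 * n%:R) *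
    Num.min 1 (beta^-1 * ((4 * beta)^-1 + log_plus (2 * beta))))%:E)%E.
Proof.
move=> W beta; rewrite min_factor_eq1// mulr1.
have n0 : 0 < n%:R :> R by rewrite ltr0n.
pose d := c / n%:R; have d0 : 0 < d by rewrite divr_gt0.
pose p k : R := k.+1%:R^-1; pose b k := d * k.+1%:R.
have p01 k : 0 <= p k <= 1 by rewrite /p invr_ge0 ler0n/= invf_le1 ?ltr0n// ler1n.
have b0 k : 0 < b k by rewrite mulr_gt0.
have pbd k : p k * b k = d by rewrite /p /b mulrCA mulVf ?mulr1 ?pnatr_eq0.
have hB' (k : 'I_n) : P1 [set w | B k w = true] = (p k)%:E.
  rewrite -[LHS]/(distribution P1 (B k) [set true]) hB bernoulli_probE ?p01//.
  by rewrite !diracE mem_set// memNset// mule1 mule0 adde0.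
have hPo' (k : 'I_n) j : P1 [set w | Po k w = j] = (pois (b k) j)%:E.
  have bE : c * k.+1%:R / n%:R = b k by rewrite /b /d mulrAC.
  by rewrite hPo bE /poisson_pmf b0 /pois mulrC.
have WE := prob_bern_pois_sum p01 (fun k => ltW (b0 k)) hB' hPo' hind.
have [z [lz zK ZE]] := mixed_poisson_dickman_law hc hD hZ.
apply: ge_ereal_sup => _ [A _ <-].
rewrite /W WE ZE -EFinB abse_EFin lee_fin.
have cE : c = d * n%:R by rewrite /d divfK ?gt_eqF.
have h01 m : 0 <= ((m \in A)%:R : R) <= 1 by case: (m \in A); rewrite /= ?ler01 ?lexx.
apply: (le_trans (sumshift_fixed_point_dist (ltW hc) p01 (ltW d0) pbd (fun=> erefl) cE lz zK h01)).
rewrite le_eqVlt; apply/orP; left; apply/eqP; rewrite /d.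
by field; rewrite gt_eqF.
Qed.
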